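(* Let $K$ be an algebraically closed field, let $\mathcal N = K\langle x_1,\dots,x_n\rangle/\langle x_ix_j+x_jx_i \mid 1\le i<j\le n\rangle$, let $M\subset \mathcal N^m$ be a finitely generated left $\mathcal N$-submodule, let $>_m$ be a module monomial ordering on $\mathcal N^m$, and let $\mathcal G=(f_1,\dots,f_r)$ be an ordered left Gröbner basis of $M$ with respect to $>_m$, with all $f_i\neq 0$. Let $\phi:\mathcal N^r\to\mathcal N^m$ be the left $\mathcal N$-linear map with $\phi(e_i)=f_i$, let $\operatorname{Syz}(\mathcal G)=\ker\phi$, and let $\succ_{\mathcal G}$ be the Schreyer ordering on $\mathcal N^r$ induced by $>_m$ and $\mathcal G$. Consider the algorithms LiftTree, LiftSubtree, LeadSyz and LiftSyz given in the context. Then: (1) For every term $s\in \operatorname{L}(\operatorname{Syz}(\mathcal G))\subset \mathcal N^r$, LiftTree applied to $s$ terminates and returns a lift of $s$ with respect to $\mathcal G$ and $\succ_{\mathcal G}$, that is, a vector $\bar s\in \operatorname{Syz}(\mathcal G)$ with $\operatorname{LT}_{\succ_{\mathcal G}}(\bar s)=s$. (2) For every term $s\in\mathcal N^r$, LiftSubtree applied to $s$ terminates and returns a subtree lifting of $s$ with respect to $\mathcal G$ and $>_m$, that is, a vector $\bar s\in \mathcal N^r$ with $\operatorname{LT}_{\succ_{\mathcal G}}(\bar s)=s$ such that $\phi(\bar s)-\operatorname{LT}(\phi(\bar s))$ is a sum of lower order terms with respect to $\mathcal G$ and $>_m$. (3) Consequently, LiftSyz applied to $\mathcal G$ returns a Gröbner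 basis of $\operatorname{Syz}(\mathcal G)\subset\mathcal N^r$ with respect to the Schreyer ordering $\succ_{\mathcal G}$.
   Context: **Ring.** In $\mathcal N$ one has $x_ix_j=-x_jx_i$ for $i\ne j$ (the squares $x_i^2$ are nonzero). The standard monomials $x^\alpha=x_1^{\alpha_1}\cdots x_n^{\alpha_n}$, $\alpha\in\mathbb Z_{\ge0}^n$, form a $K$-basis of $\mathcal N$, and $x^\alpha x^\gamma=\varepsilon(\alpha,\gamma)x^{\alpha+\gamma}$ with $\varepsilon(\alpha,\gamma)=(-1)^{\sum_{p>q}\alpha_p\gamma_q}$. All modules are left modules. **Monomials and orderings.** In a free module $\mathcal N^k$ with canonical basis $e_1,\dots,e_k$, a monomial is $x^\alpha e_i$ and a term is $c\,x^\alpha e_i$ with $c\in K^*$ (likewise terms $c\,x^\alpha$ of $\mathcal N$). The terms of an element are those in its expansion in standard monomials. A monomial ordering on $\mathcal N$ is a well-ordering $>$ of the standard monomials such that, for standard monomials $u,v,w,s$: $u>w$ implies $\operatorname{LM}(vus)>\operatorname{LM}(vws)$; and $u=\operatorname{LM}(vws)$ with $v\neq1$ or $s\ne1$ implies $u>w$. (Equivalently, on exponents it is a monomial well-ordering of the commutative polynomial ring.) A module monomial ordering on $\mathcal N^k$ is, as in the commutative case, a well-ordering of the monomials of $\mathcal N^k$ compatible with a monomial ordering $>$ on $\mathcal N$: $x^\alpha e_i>_m x^\beta e_j$ implies $x^{\alpha+\gamma}e_i>_m x^{\beta+\gamma}e_j$, and $x^\alpha>x^\beta$ implies $x^\alpha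 e_i>_m x^\beta e_i$. For nonzero $f$, $\operatorname{LM}(f)$ is its largest monomial (standard form, coefficient $1$) and $\operatorname{LT}(f)$ its lead term (including the coefficient). Terms are compared via their monomials. A monomial $x^\alpha e_i$ divides $x^\gamma e_j$ iff $i=j$ and $\alpha\le\gamma$ componentwise. $\operatorname{LCM}(x^\alpha e_i,x^\gamma e_j)$ is $x^{\max(\alpha,\gamma)}e_i$ (componentwise maximum) if $i=j$, and $0$ otherwise. For terms $s=a x^\alpha e_i$, $t=b x^\gamma e_i$ with $\alpha\le\gamma$, put $\operatorname{lquot}(t,s)=\dfrac{b}{a\,\varepsilon(\gamma-\alpha,\alpha)}x^{\gamma-\alpha}$, so that $\operatorname{lquot}(t,s)\,s=t$. **Gröbner bases.** A finite generating subset $\mathcal G$ of a left submodule $M\subset\mathcal N^k$ is a (left) Gröbner basis of $M$ if every $p\in M$ can be written $p=\sum_i u_ig_i$ with $u_i\in\mathcal N$, $g_i\in\mathcal G$ and $\operatorname{LM}(p)\ge_m\operatorname{LM}(u_ig_i)$ for all nonzero $u_ig_i$. Equivalently, the lead module $\operatorname{L}(M)$, i.e. the left module generated by the lead monomials of all nonzero elements of $M$, is generated by $\{\operatorname{LM}(g)\mid g\in\mathcal G\}$. $\operatorname{L}(\operatorname{Syz}(\mathcal G))$ is taken with respect to $\succ_{\mathcal G}$. **Schreyer ordering.** $x^\alpha e_i\succ_{\mathcal G}x^\beta e_j$ iff $\operatorname{LM}(x^\alpha f_i)>_m\operatorname{LM}(x^\beta f_j)$, or $\operatorname{LM}(x^\alpha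 f_i)=\operatorname{LM}(x^\beta f_j)$ and $i<j$. **Lower order terms.** A term $t\in\mathcal N^m$ is a lower order term with respect to $\mathcal G$ if $\operatorname{LM}(f)\nmid\operatorname{LM}(t)$ for all $f\in\mathcal G$. $\operatorname{LOT}(g|\mathcal G)$ denotes the sum of those terms of $g$ that are lower order terms with respect to $\mathcal G$. **Quantities $m_{ji}$.** For $i<j$ with $\operatorname{LCM}(\operatorname{LM}(f_j),\operatorname{LM}(f_i))\ne0$, put $m_{ji}=\operatorname{lquot}(\operatorname{LCM}(\operatorname{LM}(f_j),\operatorname{LM}(f_i)),\operatorname{LT}(f_i))$. **LeadSyz($\mathcal G$).** Start with $S:=\emptyset$. For each pair $1\le i<j\le r$ with $\operatorname{LCM}(\operatorname{LM}(f_j),\operatorname{LM}(f_i))\neq0$: let $t:=\operatorname{LM}(m_{ji})e_i\in\mathcal N^r$; run through the elements $s\in S$: if $s\mid t$, set $t:=0$ and stop running through $S$; else if $t\mid s$, remove $s$ from $S$. If afterwards $t\neq0$, add $t$ to $S$. Return $S$. **LiftTree($s$)**, for a term $s\in\operatorname{L}(\operatorname{Syz}(\mathcal G))$. Let $g:=\phi(s)$, let $T$ be the set of terms of $g-\operatorname{LOT}(g|\mathcal G)$, and $\bar s:=s$. For each $t\in T$: choose a term $-me_i$ of $\mathcal N^r$ such that $m\operatorname{LT}(f_i)=t$ and $s\succ_{\mathcal G}me_i$, and set $\bar s:=\bar s+\text{LiftSubtree}(-me_i)$. Return $\bar s$. **LiftSubtree($s$)**, for a term $s\in\mathcal N^r$.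 Let $g:=\phi(s)-\operatorname{LT}(\phi(s))$, let $T$ be the set of terms of $g-\operatorname{LOT}(g|\mathcal G)$, and $\bar s:=s$. For each $t\in T$: choose a term $-me_i$ of $\mathcal N^r$ such that $m\operatorname{LT}(f_i)=t$, and set $\bar s:=\bar s+\text{LiftSubtree}(-me_i)$ (recursive call). Return $\bar s$. In both algorithms, $m\operatorname{LT}(f_i)=t$ means equality of terms including coefficients and signs, after writing monomials in standard form. Any choice satisfying the stated condition is allowed; termination and correctness include that the required choices exist. **LiftSyz($\mathcal G$).** Let $S:=\text{LeadSyz}(\mathcal G)$ and return $\bar S:=\{\text{LiftTree}(s)\mid s\in S\}$. *)

(* Defs.v *)
From HB Require Import structures.
From mathcomp Require Import all_boot all_order all_algebra.
From mathcomp Require Import mpoly.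

Set Implicit Arguments.
Unset Strict Implicit.
Unset Printing Implicit Defensive.

Import GRing.Theory.
Local Open Scope ring_scope.

(* The ring N = K<x_1,...,x_n> / <x_i x_j + x_j x_i | i < j>, realised on its
   K-basis of standard monomials x^a: the underlying K-vector space is that of
   {mpoly K[n]} (so p@_a is the coefficient of x^a in p and msupp p lists the
   monomials occurring in p), with the product x^a x^c = eps(a, c) x^(a+c).
   [skew_rel] and [skew_universal] show that this is the K-algebra presented by
   the generators x_i and the relations x_i x_j + x_j x_i = 0 (i < j), and
   [xmonE] that x^a is the product x_1^a_1 ... x_n^a_n. *)
Definition skewpoly (n : nat) (K : fieldType) : Type := {mpoly K[n]}.

HB.instance Definition _ n (K : fieldType) :=
  GRing.Lmodule.copy (skewpoly n K) {mpoly K[n]}.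

(* The exponent of -1 in eps(a, c). *)
Definition inversions n (a c : 'X_{1..n}) : nat :=
  \sum_(p < n) \sum_(q < n | q < p) a p * c q.

Definition eps n (K : fieldType) (a c : 'X_{1..n}) : K :=
  (-1) ^+ inversions a c.

Definition xmon n (K : fieldType) (a : 'X_{1..n}) : skewpoly n K := 'X_[a].

Definition skew_mul n (K : fieldType) (p q : skewpoly n K) : skewpoly n K :=
  \sum_(a <- msupp p) \sum_(c <- msupp q)
    (p@_a * q@_c * eps K a c) *: xmon K (a + c).

Section SkewRing.
Variables (n : nat) (K : fieldType).
Implicit Types (p q : skewpoly n K) (a b c : 'X_{1..n}).

Lemma inversionsDl a b c :
  inversions (a + b) c = (inversions a c + inversions b c)%N.
Proof.
rewrite /inversions -big_split; apply: eq_bigr => i _ /=.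
by rewrite -big_split; apply: eq_bigr => j _; rewrite mnmDE mulnDl.
Qed.

Lemma inversionsDr a b c :
  inversions a (b + c) = (inversions a b + inversions a c)%N.
Proof.
rewrite /inversions -big_split; apply: eq_bigr => i _ /=.
by rewrite -big_split; apply: eq_bigr => j _; rewrite mnmDE mulnDr.
Qed.

Lemma inversions0l a : inversions 0%MM a = 0%N.
Proof. by apply: big1 => i _; apply: big1 => j _; rewrite mnm0E. Qed.

Lemma inversions0r a : inversions a 0%MM = 0%N.
Proof. by apply: big1 => i _; apply: big1 => j _; rewrite mnm0E muln0. Qed.

Lemma inversions1 (i j : 'I_n) : inversions U_(i) U_(j) = (j < i)%N.
Proof.
rewrite /inversions (bigD1 i) //= [X in (_ + X)%N]big1 ?addn0 => [|p pi].
  case: ltnP => ji; last first.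
    apply: big1 => q qi; rewrite !mnm1E; case: (eqVneq j q) => [jq|_].
      by rewrite -jq ltnNge ji in qi.
    by rewrite muln0.
  rewrite (bigD1 j) //= big1 ?addn0 ?mnm1E ?eqxx // => q /andP[_ qj].
  by rewrite mnm1E eq_sym (negPf qj) muln0.
by apply: big1 => q _; rewrite mnm1E eq_sym (negPf pi).
Qed.

Lemma inversionsMl a c k : inversions (a *+ k) c = (k * inversions a c)%N.
Proof.
by elim: k => [|k IH]; rewrite ?mulm0n ?inversions0l // mulmS inversionsDl IH mulSn.
Qed.

Lemma inversionsMr a c k : inversions a (c *+ k) = (k * inversions a c)%N.
Proof.
by elim: k => [|k IH]; rewrite ?mulm0n ?inversions0r // mulmS inversionsDr IH mulSn.
Qed.

Let lext (V : lmodType K) (F : 'X_{1..n} -> V) p : V :=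
  \sum_(a <- msupp p) p@_a *: F a.

Let lextE (V : lmodType K) (F : 'X_{1..n} -> V) p (s : seq 'X_{1..n}) :
  uniq s -> {subset msupp p <= s} -> lext F p = \sum_(a <- s) p@_a *: F a.
Proof.
move=> us ps; rewrite /lext (bigID (mem (msupp p))) /= [RHS](bigID (mem (msupp p))) /=.
congr +%R.
  rewrite -big_filter -[RHS]big_filter; apply: perm_big; apply: uniq_perm.
  - by rewrite filter_uniq // msupp_uniq.
  - by rewrite filter_uniq.
  move=> a; rewrite !mem_filter; case: (boolP (a \in msupp p)) => //= pa.
  by rewrite ps.
rewrite !big1_seq // => a /andP[/memN_msupp_eq0 pa _]; last by rewrite pa scale0r.
by rewrite pa scale0r.
Qed.

Let lext_lin (V : lmodType K) (F : 'X_{1..n} -> V) (k : K) p q :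
  lext F (k *: p + q) = k *: lext F p + lext F q.
Proof.
pose s := undup (msupp p ++ msupp q ++ msupp (k *: p + q)).
have us : uniq s by apply: undup_uniq.
rewrite !(@lextE _ F _ s) //; try by move=> a pa; rewrite mem_undup !mem_cat pa ?orbT.
rewrite scaler_sumr -big_split; apply: eq_bigr => a _ /=.
by rewrite mcoeffD mcoeffZ scalerDl scalerA.
Qed.

Let lextX (V : lmodType K) (F : 'X_{1..n} -> V) a : lext F (xmon K a) = F a.
Proof. by rewrite /lext msuppX big_seq1 mcoeffX eqxx scale1r. Qed.

Let skew_mulE p q :
  skew_mul p q = lext (fun a => lext (fun c => eps K a c *: xmon K (a + c)) q) p.
Proof.
apply: eq_bigr => a _; rewrite scaler_sumr; apply: eq_bigr => c _.
by rewrite !scalerA.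
Qed.

Let skew_lin_ext (V : lmodType K) (f g : skewpoly n K -> V) :
  (forall k p q, f (k *: p + q) = k *: f p + f q) ->
  (forall k p q, g (k *: p + q) = k *: g p + g q) ->
  (forall a, f (xmon K a) = g (xmon K a)) -> f =1 g.
Proof.
move=> fl gl fg p.
have f0 : f 0 = 0 by have := fl (-1) 0 0; rewrite scaler0 addr0 scaleN1r addNr.
have g0 : g 0 = 0 by have := gl (-1) 0 0; rewrite scaler0 addr0 scaleN1r addNr.
have -> : p = \sum_(a <- msupp p) p@_a *: xmon K a by apply: mpolyE.
elim: (msupp p) => [|a s IH]; first by rewrite big_nil f0 g0.
by rewrite big_cons fl gl fg IH.
Qed.

Let mul_linl q k p1 p2 :
  skew_mul (k *: p1 + p2) q = k *: skew_mul p1 q + skew_mul p2 q.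
Proof. by rewrite !skew_mulE lext_lin. Qed.

Let mul_linr p k q1 q2 :
  skew_mul p (k *: q1 + q2) = k *: skew_mul p q1 + skew_mul p q2.
Proof.
rewrite !skew_mulE /lext scaler_sumr -big_split; apply: eq_bigr => a _ /=.
by rewrite -/(lext _ _) lext_lin scalerDr !scalerA mulrC.
Qed.

Let mul_xmon a c : skew_mul (xmon K a) (xmon K c) = eps K a c *: xmon K (a + c).
Proof. by rewrite skew_mulE !lextX. Qed.

Let mulZl k p q : skew_mul (k *: p) q = k *: skew_mul p q.
Proof.
have := mul_linl q k p 0; rewrite addr0 => ->.
have := mul_linl q (-1) 0 0; rewrite scaler0 addr0 scaleN1r addNr => ->.
by rewrite addr0.
Qed.

Let mulZr k p q : skew_mul p (k *: q) = k *: skew_mul p q.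
Proof.
have := mul_linr p k q 0; rewrite addr0 => ->.
have := mul_linr p (-1) 0 0; rewrite scaler0 addr0 scaleN1r addNr => ->.
by rewrite addr0.
Qed.

Let smulA : associative (@skew_mul n K).
Proof.
move=> p q r; move: p; apply: skew_lin_ext => [k p1 p2|k p1 p2|a].
- by rewrite mul_linl.
- by rewrite !mul_linl.
move: q; apply: skew_lin_ext => [k p1 p2|k p1 p2|b].
- by rewrite mul_linl mul_linr.
- by rewrite mul_linr mul_linl.
move: r; apply: skew_lin_ext => [k p1 p2|k p1 p2|c].
- by rewrite !mul_linr.
- by rewrite mul_linr.
rewrite !mul_xmon mulZl mulZr !mul_xmon !scalerA -!exprD addmA.
rewrite inversionsDl inversionsDr; congr (_ ^+ _ *: _).
by rewrite addnC addnA.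
Qed.

Let smul1l : left_id (xmon K 0%MM) (@skew_mul n K).
Proof.
apply: (@skew_lin_ext _ (skew_mul (xmon K 0%MM)) id) => [k p1 p2|k p1 p2|a] //.
by rewrite mul_xmon /eps inversions0l expr0 scale1r add0m.
Qed.

Let smul1r : right_id (xmon K 0%MM) (@skew_mul n K).
Proof.
apply: (@skew_lin_ext _ (fun p => skew_mul p _) id) => [k p1 p2|k p1 p2|a] //.
by rewrite mul_xmon /eps inversions0r expr0 scale1r addm0.
Qed.

Let smulDl : left_distributive (@skew_mul n K) +%R.
Proof. by move=> p q r; have := mul_linl r 1 p q; rewrite !scale1r. Qed.

Let smulDr : right_distributive (@skew_mul n K) +%R.
Proof. by move=> p q r; have := mul_linr p 1 q r; rewrite !scale1r. Qed.

Let one_neq0 : xmon K (0%MM : 'X_{1..n}) != 0.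
Proof.
apply/eqP => /(congr1 (mcoeff 0%MM)) /eqP.
by rewrite mcoeffX eqxx mcoeff0 oner_eq0.
Qed.

HB.instance Definition _ := GRing.Zmodule_isNzRing.Build (skewpoly n K)
  smulA smul1l smul1r smulDl smulDr one_neq0.
HB.instance Definition _ := GRing.Lmodule_isLalgebra.Build K (skewpoly n K)
  (fun k p q => esym (mulZl k p q)).
HB.instance Definition _ := GRing.Lalgebra_isAlgebra.Build K (skewpoly n K)
  (fun k p q => esym (mulZr k p q)).

Lemma xmon0 : xmon K 0%MM = 1 :> skewpoly n K.
Proof. by []. Qed.

Lemma xmonM a c : xmon K a * xmon K c = eps K a c *: xmon K (a + c).
Proof. exact: mul_xmon. Qed.

Lemma skewE p : p = \sum_(a <- msupp p) p@_a *: xmon K a.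
Proof. exact: mpolyE. Qed.

Definition xvar (i : 'I_n) : skewpoly n K := xmon K U_(i)%MM.

Lemma skew_rel (i j : 'I_n) :
  (i < j)%N -> xvar i * xvar j + xvar j * xvar i = 0.
Proof.
move=> ij; rewrite !xmonM addmC.
by rewrite /eps !inversions1 ij ltnNge (ltnW ij) /= expr0 expr1 scale1r scaleN1r subrr.
Qed.

Let sorted_enum : pairwise (fun i j : 'I_n => (i < j)%N) (index_enum 'I_n).
Proof.
have := iota_ltn_sorted 0 n; rewrite -val_enum_ord sorted_pairwise; last exact: ltn_trans.
by rewrite pairwise_map enumT.
Qed.

Lemma xmonE (a : 'X_{1..n}) : xmon K a = \prod_(i < n) xvar i ^+ a i.
Proof.
have xvarX i k : xvar i ^+ k = xmon K (U_(i) *+ k)%MM.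
  elim: k => [|k IH]; first by rewrite expr0 mulm0n.
  by rewrite exprS IH xmonM mulmS /eps inversionsMr inversions1 ltnn muln0 scale1r.
rewrite [in LHS](multinomUE_id a) (eq_bigr _ (fun i _ => xvarX i (a i))).
elim: (index_enum _) sorted_enum => [|i r IH]; first by rewrite !big_nil.
rewrite pairwise_cons => /andP[ir rs]; rewrite !big_cons -IH // xmonM /eps.
suff -> : inversions (U_(i) *+ a i) (\sum_(j <- r) U_(j) *+ a j)%MM = 0%N.
  by rewrite scale1r.
elim: r ir {rs IH} => [|j r IH] /=; first by rewrite big_nil inversions0r.
case/andP=> ij ir; rewrite big_cons inversionsDr IH // addn0.
by rewrite inversionsMl inversionsMr inversions1 ltnNge (ltnW ij) !muln0.
Qed.

Let anticomm_pow (A : algType K) (u v : A) s t :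
  u * v + v * u = 0 -> u ^+ s * v ^+ t = (-1) ^+ (s * t) *: (v ^+ t * u ^+ s).
Proof.
move=> /addr0_eq/(canRL (@opprK _)) uv.
have uvt k : u * v ^+ k = (-1) ^+ k *: (v ^+ k * u).
  elim: k => [|k IH]; first by rewrite !expr0 mul1r mulr1 scale1r.
  rewrite exprS mulrA uv mulNr -(mulrA v u) IH -scalerAr mulrA -exprS.
  by rewrite -scaleN1r scalerA -exprS.
elim: s => [|s IH]; first by rewrite mul0n !expr0 mulr1 mul1r scale1r.
rewrite exprS -(mulrA u) IH -scalerAr (mulrA u) uvt -scalerAl scalerA -mulrA.
by rewrite -exprD mulSn addnC.
Qed.

Let prodM (A : algType K) (y : 'I_n -> A) (a c : 'X_{1..n}) :
  (forall i j : 'I_n, (i < j)%N -> y i * y j + y j * y i = 0) ->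
  (\prod_(i < n) y i ^+ a i) * (\prod_(i < n) y i ^+ c i) =
  eps K a c *: \prod_(i < n) y i ^+ (a + c)%MM i.
Proof.
move=> yC; rewrite /eps /inversions.
elim: (index_enum _) sorted_enum => [|i r IH].
  by rewrite !big_nil mulr1 scale1r.
rewrite pairwise_cons => /andP[ir /IH{IH}IH]; rewrite !big_cons ltnn.
have pull s : (\prod_(j <- r) y j ^+ a j) * y i ^+ s =
   (-1) ^+ (\sum_(j <- r) a j * s) *: (y i ^+ s * \prod_(j <- r) y j ^+ a j).
  elim: r ir {IH} => [|j r IH] /=; first by rewrite !big_nil mulr1 mul1r scale1r.
  case/andP=> ij /IH{}IH; rewrite !big_cons -mulrA IH -scalerAr.
  have yji : y j * y i + y i * y j = 0 by rewrite addrC yC.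
  rewrite (mulrA (y j ^+ _)) (anticomm_pow _ _ yji) -scalerAl scalerA -exprD.
  by rewrite addnC mulrA.
rewrite -mulrA [X in _ * X]mulrA pull -scalerAl -scalerAr -mulrA IH.
rewrite -!scalerAr scalerA mulrA -exprD -[X in _ *: (X * _)]exprD mnmDE.
congr (_ ^+ _ *: _).
rewrite [X in _ = (X + _)%N]big1_seq ?add0n => [|j /andP[ji jr]]; last first.
  by have := allP ir _ jr; rewrite /= ltnNge (ltnW ji).
rewrite -big_split; apply: eq_big_seq => j /(allP ir) /= ij.
by rewrite big_cons ij.
Qed.

Theorem skew_universal (A : algType K) (y : 'I_n -> A) :
    (forall i j : 'I_n, (i < j)%N -> y i * y j + y j * y i = 0) ->
  exists f : {lrmorphism skewpoly n K -> A},
    (forall i, f (xvar i) = y i) /\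
    (forall g : {lrmorphism skewpoly n K -> A},
       (forall i, g (xvar i) = y i) -> g =1 f).
Proof.
move=> yC.
pose Y (a : 'X_{1..n}) := \prod_(i < n) y i ^+ a i.
pose f (p : skewpoly n K) : A := lext Y p.
have fX a : f (xmon K a) = Y a by apply: lextX.
have flin : linear f by move=> k p q; apply: lext_lin.
pose fL : {linear skewpoly n K -> A} := HB.pack f (GRing.isLinear.Build _ _ _ _ f flin).
have fmul : monoid_morphism f.
  split; first by rewrite -xmon0 fX /Y big1 // => i _; rewrite mnm0E.
  move=> p q; move: p; apply: skew_lin_ext => [k p1 p2|k p1 p2|a].
  - by rewrite mulrDl -scalerAl flin.
  - by rewrite flin mulrDl -scalerAl.
  move: q; apply: skew_lin_ext => [k p1 p2|k p1 p2|c].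
  - by rewrite mulrDr -scalerAr flin.
  - by rewrite flin mulrDr -scalerAr.
  by rewrite xmonM -[f]/(fL : _ -> _) linearZ /= !fX /Y prodM.
pose F : {lrmorphism skewpoly n K -> A} :=
  HB.pack f (GRing.isLinear.Build _ _ _ _ f flin)
            (GRing.isMonoidMorphism.Build _ _ f fmul).
exists F; split=> [i|g gy].
  rewrite -[RHS](_ : Y U_(i)%MM = _); first exact: fX.
  exact: mmap1U.
apply: skew_lin_ext => [k p q|k p q|a]; rewrite ?linearP //.
rewrite -[F _]/(f _) fX xmonE rmorph_prod; apply: eq_bigr => i _.
by rewrite rmorphXn /= gy.
Qed.

End SkewRing.

(* The pair (a, i) stands for the monomial x^a e_i of N^k. *)
Notation vmon n k := ('X_{1..n} * 'I_k)%type.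

Definition basis_vec n (K : fieldType) k (i : 'I_k) : 'rV[skewpoly n K]_k :=
  delta_mx 0 i.

Definition vterm n (K : fieldType) k (c : K) (mu : vmon n k) : 'rV[skewpoly n K]_k :=
  (c *: xmon K mu.1) *: basis_vec n K mu.2.

Definition is_term n (K : fieldType) (u : skewpoly n K) : Prop :=
  exists (c : K) (a : 'X_{1..n}), c != 0 /\ u = c *: xmon K a.

Definition is_vterm n (K : fieldType) k (v : 'rV[skewpoly n K]_k) : Prop :=
  exists (c : K) (mu : vmon n k), c != 0 /\ v = vterm c mu.

Definition vcoef n (K : fieldType) k (v : 'rV[skewpoly n K]_k) (mu : vmon n k) : K :=
  (v 0 mu.2)@_mu.1.

Definition vsupp n (K : fieldType) k (v : 'rV[skewpoly n K]_k) : seq (vmon n k) :=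
  [seq (a, i) | i <- enum 'I_k, a <- msupp (v 0 i)].

Definition vterms n (K : fieldType) k (v : 'rV[skewpoly n K]_k) :
    seq 'rV[skewpoly n K]_k :=
  [seq vterm (vcoef v mu) mu | mu <- vsupp v].

Section LeftSpan.
Variables (R : nzRingType) (V : lmodType R).

Definition lspan (P : V -> Prop) (v : V) : Prop :=
  exists l : seq (R * V),
    (forall p, p \in l -> P p.2) /\ v = \sum_(p <- l) p.1 *: p.2.

Definition submodule (M : V -> Prop) : Prop :=
  M 0 /\ (forall (a : R) u v, M u -> M v -> M (a *: u + v)).

Definition generates (G : seq V) (M : V -> Prop) : Prop :=
  forall v, M v <-> lspan (fun g => g \in G) v.

Definition finitely_generated (M : V -> Prop) : Prop :=
  exists G : seq V, generates G M.

End LeftSpan.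

(* An ordering > is given by its strict part, [gt a b] meaning a > b. *)
Definition well_order (T : eqType) (gt : rel T) : Prop :=
  [/\ irreflexive gt, transitive gt,
      (forall a b, a != b -> gt a b || gt b a)
    & well_founded (fun a b => gt b a)].

(* The largest element of s, or None if s is empty. *)
Definition largest (T : eqType) (gt : rel T) (s : seq T) : option T :=
  ohead [seq a <- s | all (fun b => (b == a) || gt a b) s].

Definition oge (T : eqType) (gt : rel T) (a b : option T) : bool :=
  if (a, b) is (Some a', Some b') then (a' == b') || gt a' b' else false.

Definition ogt (T : eqType) (gt : rel T) (a b : option T) : bool :=
  if (a, b) is (Some a', Some b') then gt a' b' else false.

(* Lead monomials in N and in N^k; they are None exactly for the zero element. *)
Definition LM1 n (K : fieldType) (gt : rel 'X_{1..n}) (p : skewpoly n K) :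
    option 'X_{1..n} :=
  largest gt (msupp p).

Definition LM n (K : fieldType) k (gt : rel (vmon n k)) (v : 'rV[skewpoly n K]_k) :
    option (vmon n k) :=
  largest gt (vsupp v).

(* With LT(0) = 0. *)
Definition LT n (K : fieldType) k (gt : rel (vmon n k)) (v : 'rV[skewpoly n K]_k) :
    'rV[skewpoly n K]_k :=
  if LM gt v is Some mu then vterm (vcoef v mu) mu else 0.

Definition monomial_ordering n (K : fieldType) (gt : rel 'X_{1..n}) : Prop :=
  [/\ well_order gt,
      (forall u v w s : 'X_{1..n}, gt u w ->
        ogt gt (LM1 gt (xmon K v * xmon K u * xmon K s))
               (LM1 gt (xmon K v * xmon K w * xmon K s)))
    & (forall u v w s : 'X_{1..n},
        Some u = LM1 gt (xmon K v * xmon K w * xmon K s) ->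
        v != 0%MM \/ s != 0%MM -> gt u w)].

Definition module_monomial_ordering n (K : fieldType) k (gt : rel (vmon n k)) :
    Prop :=
  well_order gt /\
  exists gt1 : rel 'X_{1..n}, monomial_ordering K gt1 /\
    (forall (a b c : 'X_{1..n}) (i j : 'I_k),
       gt (a, i) (b, j) -> gt ((a + c)%MM, i) ((b + c)%MM, j)) /\
    (forall (a b : 'X_{1..n}) (i : 'I_k), gt1 a b -> gt (a, i) (b, i)).

(* Divisibility and least common multiple of monomials, None being the zero
   vector. *)
Definition mdivides n k (s t : option (vmon n k)) : bool :=
  if (s, t) is (Some (a, i), Some (c, j)) then (i == j) && (a <= c)%MM
  else false.

Definition mlcm n k (s t : option (vmon n k)) : option (vmon n k) :=
  if (s, t) is (Some (a, i), Some (c, j)) then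
    if i == j then Some ([multinom maxn (a l) (c l) | l < n], i) else None
  else None.

Definition lead_module n (K : fieldType) k (gt : rel (vmon n k))
    (M : 'rV[skewpoly n K]_k -> Prop) : 'rV[skewpoly n K]_k -> Prop :=
  lspan (fun v => exists p mu,
    [/\ M p, p != 0, LM gt p = Some mu & v = vterm 1 mu]).

Definition grobner_basis n (K : fieldType) k (gt : rel (vmon n k))
    (M : 'rV[skewpoly n K]_k -> Prop) (G : seq 'rV[skewpoly n K]_k) : Prop :=
  generates G M /\
  (forall p, M p -> exists u : nat -> skewpoly n K,
     p = \sum_(i < size G) u i *: G`_i /\
     (forall i, (i < size G)%N -> u i *: G`_i != 0 ->
        oge gt (LM gt p) (LM gt (u i *: G`_i)))).

Section Schreyer.
Variables (n : nat) (K : fieldType) (m r : nat).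
Variables (gt : rel (vmon n m)) (G : r.-tuple 'rV[skewpoly n K]_m).

Local Notation f := (tnth G).
Local Notation e := (basis_vec n K).

Definition phi (v : 'rV[skewpoly n K]_r) : 'rV[skewpoly n K]_m :=
  \sum_(i < r) v 0 i *: f i.

Definition Syz (v : 'rV[skewpoly n K]_r) : Prop := phi v = 0.

Definition schreyer : rel (vmon n r) := fun s t =>
  let lms := LM gt (xmon K s.1 *: f s.2) in
  let lmt := LM gt (xmon K t.1 *: f t.2) in
  ogt gt lms lmt || ((lms == lmt) && (s.2 < t.2)%N).

Definition lower_order (t : 'rV[skewpoly n K]_m) : bool :=
  all (fun g => ~~ mdivides (LM gt g) (LM gt t)) G.

Definition LOT (g : 'rV[skewpoly n K]_m) : 'rV[skewpoly n K]_m :=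
  \sum_(t <- vterms g | lower_order t) t.

Definition sum_of_lower_order (v : 'rV[skewpoly n K]_m) : Prop :=
  exists T : seq 'rV[skewpoly n K]_m,
    (forall t, t \in T -> is_vterm t /\ lower_order t) /\ v = \sum_(t <- T) t.

(* lquot(t, s) for terms t and s of N^m such that LM(s) divides LM(t). *)
Definition lquot (t s : 'rV[skewpoly n K]_m) : skewpoly n K :=
  if (LM gt t, LM gt s) is (Some mt, Some ms) then
    let d := (mt.1 - ms.1)%MM in
    (vcoef t mt / (vcoef s ms * eps K d ms.1)) *: xmon K d
  else 0.

(* [mji j i] is m_{ji}, and 0 if LCM(LM(f_j), LM(f_i)) = 0. *)
Definition mji (j i : 'I_r) : skewpoly n K :=
  if mlcm (LM gt (f j)) (LM gt (f i)) is Some l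
  then lquot (vterm 1 l) (LT gt (f i)) else 0.

(* The pairs i < j with LCM(LM(f_j), LM(f_i)) != 0. *)
Definition lead_pairs : seq ('I_r * 'I_r) :=
  [seq p : 'I_r * 'I_r <- enum {: 'I_r * 'I_r}
     | (p.1 < p.2)%N && (mlcm (LM gt (f p.2)) (LM gt (f p.1)) != None)].

(* Running t through the list S: the outcome is the value of t (None for 0)
   and what is left of S. *)
Fixpoint scan (t : vmon n r) (S : seq (vmon n r)) :
    option (vmon n r) * seq (vmon n r) :=
  if S is s :: S' then
    if mdivides (Some s) (Some t) then (None, S) else
    let: (o, S'') := scan t S' in
    (o, if mdivides (Some t) (Some s) then S'' else s :: S'')
  else (Some t, [::]).

(* The lead monomial of m_{ji} e_i is LM(m_{ji}) e_i. *)
Definition process_pair (p : 'I_r * 'I_r) (S : seq (vmon n r)) :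
    seq (vmon n r) :=
  if LM schreyer (mji p.2 p.1 *: e p.1) is Some t then
    let: (o, S') := scan t S in if o is Some t' then t' :: S' else S'
  else S.

(* [leadsyz_run ps S S'] : S' is a possible value of the set S after treating
   the pairs ps. The algorithm leaves open the order in which a set is run
   through, whence the permutations. *)
Inductive leadsyz_run :
    seq ('I_r * 'I_r) -> seq (vmon n r) -> seq (vmon n r) -> Prop :=
| leadsyz_nil S : leadsyz_run [::] S S
| leadsyz_cons p ps S S0 S' :
    perm_eq S0 S -> leadsyz_run ps (process_pair p S0) S' ->
    leadsyz_run (p :: ps) S S'.

Definition LeadSyz (S : seq (vmon n r)) : Prop :=
  exists ps, perm_eq ps lead_pairs /\ leadsyz_run ps [::] S.

(* The sets T of LiftSubtree(s) and LiftTree(s). *)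
Definition subtree_todo (s : 'rV[skewpoly n K]_r) : seq 'rV[skewpoly n K]_m :=
  let g := phi s - LT gt (phi s) in vterms (g - LOT g).

Definition tree_todo (s : 'rV[skewpoly n K]_r) : seq 'rV[skewpoly n K]_m :=
  let g := phi s in vterms (g - LOT g).

(* The admissible choices of -u e_i for t \in T. *)
Definition subtree_choice (t : 'rV[skewpoly n K]_m) (u : skewpoly n K) (i : 'I_r) :
    Prop :=
  is_term u /\ u *: LT gt (f i) = t.

Definition tree_choice (s : 'rV[skewpoly n K]_r) (t : 'rV[skewpoly n K]_m)
    (u : skewpoly n K) (i : 'I_r) : Prop :=
  subtree_choice t u i /\ ogt schreyer (LM schreyer s) (LM schreyer (u *: e i)).

(* [LiftSubtree s sbar] : some execution on s returns sbar. Here u t and i t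
   give the term chosen for t, and ret t is the result of the recursive call. *)
Inductive LiftSubtree : 'rV[skewpoly n K]_r -> 'rV[skewpoly n K]_r -> Prop :=
| LiftSubtree_run s (u : 'rV[skewpoly n K]_m -> skewpoly n K)
    (i : 'rV[skewpoly n K]_m -> 'I_r) (ret : 'rV[skewpoly n K]_m -> 'rV[skewpoly n K]_r) :
    (forall t, t \in subtree_todo s -> subtree_choice t (u t) (i t)) ->
    (forall t, t \in subtree_todo s -> LiftSubtree (- (u t *: e (i t))) (ret t)) ->
    LiftSubtree s (s + \sum_(t <- subtree_todo s) ret t).

Definition LiftTree (s sbar : 'rV[skewpoly n K]_r) : Prop :=
  exists (u : 'rV[skewpoly n K]_m -> skewpoly n K) (i : 'rV[skewpoly n K]_m -> 'I_r)
         (ret : 'rV[skewpoly n K]_m -> 'rV[skewpoly n K]_r),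
    [/\ (forall t, t \in tree_todo s -> tree_choice s t (u t) (i t)),
        (forall t, t \in tree_todo s -> LiftSubtree (- (u t *: e (i t))) (ret t))
      & sbar = s + \sum_(t <- tree_todo s) ret t].

(* Every execution terminates: along every sequence of choices each required
   choice exists and the recursion is well-founded. *)
Inductive LiftSubtree_terminates : 'rV[skewpoly n K]_r -> Prop :=
| LiftSubtree_terminates_intro s :
    (forall t, t \in subtree_todo s -> exists u i, subtree_choice t u i) ->
    (forall t u i, t \in subtree_todo s -> subtree_choice t u i ->
       LiftSubtree_terminates (- (u *: e i))) ->
    LiftSubtree_terminates s.

Definition LiftTree_terminates (s : 'rV[skewpoly n K]_r) : Prop :=
  (forall t, t \in tree_todo s -> exists u i, tree_choice s t u i) /\
  (forall t u i, t \in tree_todo s -> tree_choice s t u i ->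
     LiftSubtree_terminates (- (u *: e i))).

Definition LiftSyz (Sbar : seq 'rV[skewpoly n K]_r) : Prop :=
  exists (S : seq (vmon n r)) (lift : vmon n r -> 'rV[skewpoly n K]_r),
    [/\ LeadSyz S,
        (forall s, s \in S -> LiftTree (vterm 1 s) (lift s))
      & Sbar = [seq lift s | s <- S]].

(* LeadSyz returns, and LiftTree is only called on valid inputs, on which it
   terminates. *)
Definition LiftSyz_terminates : Prop :=
  (exists S, LeadSyz S) /\
  (forall S s, LeadSyz S -> s \in S ->
     lead_module schreyer Syz (vterm 1 s) /\ LiftTree_terminates (vterm 1 s)).

Definition is_lift (s sbar : 'rV[skewpoly n K]_r) : Prop :=
  Syz sbar /\ LT schreyer sbar = s.

Definition is_subtree_lifting (s sbar : 'rV[skewpoly n K]_r) : Prop :=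
  LT schreyer sbar = s /\ sum_of_lower_order (phi sbar - LT gt (phi sbar)).

End Schreyer.

(* Main.v *)
(* The value of phi on a term u e_i has lead monomial LM(u f_i), and a recursive
   call replaces it by terms with strictly smaller image; this gives termination.
   Each call cancels the reducible terms below the lead term up to lower order
   terms, so phi of the output of LiftTree is a sum of lower order terms lying in
   M, which vanishes because G is a Groebner basis. The lead term s of a syzygy
   must cancel under phi against a term of larger index, whence the admissible
   choices in LiftTree and the fact that some LM(m_ji) e_i divides s. *)
Require Import Defs.
From mathcomp Require Import all_boot all_order all_algebra.
From mathcomp Require Import mpoly.

Set Implicit Arguments.
Unset Strict Implicit.
Unset Printing Implicit Defensive.

Import GRing.Theory.
Local Open Scope ring_scope.

(** The signs of N only multiply coefficients by units, so lead monomials behave as over a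
    commutative polynomial ring; signs matter only where lead terms are matched exactly. Since the
    choices are free, an execution is a relation, and termination, existence of an execution and
    correctness of every execution are three separate facts. In LiftSubtree descent of images in
    [gt] already gives descent in the Schreyer ordering, whatever index is chosen. At the root of
    LiftTree the lead term of phi(s) may itself have to be cancelled, and only there does the index
    matter. That LM(m_ji) e_i is the lead monomial of a syzygy, so that LiftTree is called on valid
    input, comes from a standard representation of the S-vector of f_i and f_j. *)

Lemma seq_choice (T : eqType) (U : Type) (P : T -> U -> Prop) (s : seq T) (u0 : U) :
    (forall x, x \in s -> exists y, P x y) ->
  exists f, forall x, x \in s -> P x (f x).
Proof.
elim: s => [|x s IH] ex; first by exists (fun=> u0).
have [y Pxy] := ex x (mem_head _ _).
have [z zs|f fP] := IH; first by apply: ex; rewrite inE zs orbT.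
exists (fun z => if z == x then y else f z) => z; rewrite inE.
by case: eqVneq => [->|_ /fP].
Qed.

(** * Coefficients of vectors and left multiplication by terms *)

Section Coefficients.
Variables (n : nat) (K : fieldType) (k : nat).
Local Notation R := (skewpoly n K).
Implicit Types (v w : 'rV[R]_k) (mu nu : vmon n k) (a b : 'X_{1..n}) (c : K).

(** Exponents act on monomials without signs; the sign of x^a x^mu.1 is left to the coefficients. *)
Definition mshift a mu : vmon n k := ((a + mu.1)%MM, mu.2).

Lemma eps_neq0 a b : eps K a b != 0.
Proof. by rewrite /eps signr_eq0. Qed.

(** Translation by a is injective on exponents, so a single term of q reaches x^(a+b), and
    noncommutativity shows only as a unit. *)
Lemma mcoeff_xmon_mul a (q : R) b : (xmon K a * q)@_(a + b) = eps K a b * q@_b.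
Proof.
rewrite {1}(skewE q) mulr_sumr linear_sum /= [q in RHS]skewE linear_sum mulr_sumr /=.
apply: eq_bigr => d _; rewrite -scalerAr xmonM !mcoeffZ !mcoeffX mulrCA.
by rewrite eqm_add2l; case: eqVneq => [->|_]; rewrite ?mulr0.
Qed.

Lemma mcoeff_xmon_mul_neq0 a (q : R) b :
  (xmon K a * q)@_b != 0 -> exists d, b = (a + d)%MM.
Proof.
move=> nz; have [/mapP[d _ ->]|bNs] := boolP (b \in map (mnm_add a) (msupp q)).
  by exists d.
case/eqP: nz; rewrite (skewE q) mulr_sumr linear_sum big1_seq //= => d dq.
rewrite -scalerAr xmonM !mcoeffZ !mcoeffX; case: eqVneq => [adb|_]; last by rewrite !mulr0.
by case/mapP: bNs; exists d.
Qed.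

Lemma vcoefD v w mu : vcoef (v + w) mu = vcoef v mu + vcoef w mu.
Proof. by rewrite /vcoef mxE mcoeffD. Qed.

Lemma vcoefN v mu : vcoef (- v) mu = - vcoef v mu.
Proof. by rewrite /vcoef mxE mcoeffN. Qed.

Lemma vcoef0 mu : vcoef (0 : 'rV[R]_k) mu = 0.
Proof. by rewrite /vcoef mxE mcoeff0. Qed.

Lemma vcoef_vterm c mu nu : vcoef (vterm c mu) nu = c *+ (mu == nu).
Proof.
case: mu nu => a i [b j]; rewrite /vcoef /vterm !mxE /= xpair_eqE eq_sym.
case: (eqVneq i j) => _; last by rewrite mulr0 mcoeff0 andbF.
by rewrite mulr1 mcoeffZ mcoeffX andbT; case: eqP; rewrite ?mulr1 ?mulr0.
Qed.

Lemma vcoef_sum (I : Type) (s : seq I) (P : pred I) (F : I -> 'rV[R]_k) mu :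
  vcoef (\sum_(i <- s | P i) F i) mu = \sum_(i <- s | P i) vcoef (F i) mu.
Proof.
by apply: (big_morph (fun v => vcoef v mu)); [move=> v w; apply: vcoefD|apply: vcoef0].
Qed.

Lemma vcoef_inj v w : vcoef v =1 vcoef w -> v = w.
Proof.
move=> vw; apply/rowP => i; apply/(@mpolyP n K) => a; exact: (vw (a, i)).
Qed.

Lemma vcoef_xmon_scale a c v mu :
  vcoef ((c *: xmon K a) *: v) (mshift a mu) = c * eps K a mu.1 * vcoef v mu.
Proof.
by rewrite /vcoef mxE -scalerAl mcoeffZ mcoeff_xmon_mul mulrA.
Qed.

Lemma vcoef_xmon_scale_neq0 a c v mu :
  vcoef ((c *: xmon K a) *: v) mu != 0 ->
  exists2 nu, mu = mshift a nu & vcoef v nu != 0.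
Proof.
case: mu => b i nz.
have [d bE] : exists d, b = (a + d)%MM.
  apply: (@mcoeff_xmon_mul_neq0 _ (v 0 i)); apply: contraNneq nz => z.
  by rewrite /vcoef mxE -scalerAl mcoeffZ z mulr0.
exists (d, i); first by rewrite /mshift -bE.
apply: contraNneq nz => z.
by rewrite (_ : (b, i) = mshift a (d, i)) ?vcoef_xmon_scale ?z ?mulr0 // /mshift -bE.
Qed.

Lemma scale_sum_terms (u : R) v :
  u *: v = \sum_(a <- msupp u) (u@_a *: xmon K a) *: v.
Proof. by rewrite {1}(skewE u) scaler_suml. Qed.

Lemma mem_vsupp v mu : (mu \in vsupp v) = (vcoef v mu != 0).
Proof.
case: mu => a i; rewrite /vsupp /vcoef -mcoeff_msupp /=.
apply/allpairsPdep/idP => [[j [b [_ bv [-> ->]]]] //|av].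
by exists i, a; rewrite mem_enum.
Qed.

Lemma vsupp_uniq v : uniq (vsupp v).
Proof.
apply: allpairs_uniq_dep => [|i _|].
- exact: enum_uniq.
- exact: msupp_uniq.
by move=> [i a] [j b] _ _ /= [-> ->].
Qed.

Lemma sum_vterms v : \sum_(t <- vterms v) t = v.
Proof.
apply: vcoef_inj => mu; rewrite big_map vcoef_sum.
under eq_bigr do rewrite vcoef_vterm.
have [muv|] := boolP (mu \in vsupp v).
  rewrite (bigD1_seq mu) ?vsupp_uniq //= eqxx big1 ?addr0 // => nu.
  by move/negPf->.
rewrite mem_vsupp negbK => /eqP v0; rewrite v0 big1_seq // => nu /andP[_ nuv].
by case: eqVneq => // ->; rewrite v0.
Qed.

Lemma vtermsP v t :
  reflect (exists2 mu, vcoef v mu != 0 & t = vterm (vcoef v mu) mu)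
          (t \in vterms v).
Proof.
by apply: (iffP mapP) => -[mu muv ->]; exists mu; rewrite ?mem_vsupp // -mem_vsupp.
Qed.

Lemma scale_vterm a c d mu :
  (c *: xmon K a) *: vterm d mu = vterm (c * d * eps K a mu.1) (mshift a mu).
Proof.
by rewrite /vterm scalerA -scalerAl -scalerAr xmonM !scalerA.
Qed.

Lemma vtermN c mu : - vterm c mu = vterm (- c) mu :> 'rV[R]_k.
Proof. by rewrite /vterm !scaleNr. Qed.

Lemma xmon_basis_vec a c (i : 'I_k) :
  (c *: xmon K a) *: basis_vec n K i = vterm c (a, i).
Proof. by []. Qed.

Lemma vterm_inj c d mu nu :
  c != 0 -> vterm c mu = vterm d nu :> 'rV[R]_k -> c = d /\ mu = nu.
Proof.
move=> c0 /(congr1 (fun v => vcoef v mu)); rewrite !vcoef_vterm eqxx.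
by case: eqVneq => [->|_] /=; rewrite ?mulr1n // => /eqP; rewrite (negPf c0).
Qed.

Lemma vcoef_neq0P v : v != 0 -> exists mu, vcoef v mu != 0.
Proof.
case vE: (vsupp v) => [|mu s] v0; last by exists mu; rewrite -mem_vsupp vE mem_head.
by case/eqP: v0; rewrite -[v]sum_vterms /vterms vE big_nil.
Qed.

End Coefficients.

(** * Largest elements of lists under a well-ordering *)

Section WellOrder.
Variables (T : eqType) (gt : rel T).
Hypothesis wo : well_order gt.

Lemma well_order_asym a b : gt a b -> gt b a = false.
Proof. by case: wo => irr tr _ _ ab; apply/negP => /(tr _ _ _ ab); rewrite irr. Qed.

(** By asymmetry the filtered list contains copies of at most one element, so taking its head
    involves no choice. *)
Lemma largestP (s : seq T) (a : T) :
  largest gt s = Some a <-> a \in s /\ (forall b, b \in s -> (b == a) || gt a b).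
Proof.
have [irr tr tot _] := wo.
have mem_max x : (x \in [seq a <- s | all (fun b => (b == a) || gt a b) s]) =
   (x \in s) && all (fun b => (b == x) || gt x b) s by rewrite mem_filter andbC.
rewrite /largest; split=> [|[sa amax]].
  case maxE: (filter _ _) mem_max => [//|x r] mem_max [xa]; subst x.
  by have := esym (mem_max a); rewrite mem_head => /andP[sa /allP].
have am : a \in [seq a <- s | all (fun b => (b == a) || gt a b) s].
  by rewrite mem_max sa; apply/allP.
case maxE: (filter _ _) mem_max am => [//|x r] mem_max _.
have := esym (mem_max x); rewrite mem_head => /andP[sx /allP/(_ _ sa)] /=.
have := amax _ sx; case: eqVneq => [->//|_] /= ax.
by rewrite (well_order_asym ax).
Qed.

Lemma largest_exists (s : seq T) : s != [::] -> exists a, largest gt s = Some a.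
Proof.
have [_ tr tot _] := wo.
suff: s != [::] -> exists a, a \in s /\ (forall b, b \in s -> (b == a) || gt a b).
  by move=> ex /ex[a /largestP]; exists a.
elim: s => // x [_ _|y s /(_ isT)[a [sa amax]] _].
  by exists x; split=> [|b]; rewrite ?mem_head // mem_seq1 => ->.
have [ax|axN] := boolP (gt a x).
  exists a; split=> [|b]; first by rewrite inE sa orbT.
  by rewrite inE => /predU1P[->|/amax//]; rewrite ax orbT.
exists x; split=> [|b]; first exact: mem_head.
rewrite inE => /predU1P[->|/amax]; first by rewrite eqxx.
have [->|/tot] := eqVneq a x; first by [].
rewrite (negPf axN) /= => xa /predU1P[->|/(tr _ _ _ xa)->]; last by rewrite orbT.
by rewrite xa orbT.
Qed.

End WellOrder.

(** * Lead monomials for a shift-compatible well-ordering *)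

Definition shift_compatible n k (gt : rel (vmon n k)) : Prop :=
  forall a mu nu, gt mu nu -> gt (mshift a mu) (mshift a nu).

Section LeadMonomial.
Variables (n : nat) (K : fieldType) (k : nat) (gt : rel (vmon n k)).
Hypothesis wo : well_order gt.
Local Notation R := (skewpoly n K).
Implicit Types (v w : 'rV[R]_k) (mu nu : vmon n k) (c : K).

(** Stated through coefficients and not through [LM], so that it covers v = 0 and passes to sums in
    which terms cancel. *)
Definition below v mu : Prop := forall nu, vcoef v nu != 0 -> gt mu nu.

Lemma LMP v mu :
  LM gt v = Some mu <->
  vcoef v mu != 0 /\ (forall nu, vcoef v nu != 0 -> (nu == mu) || gt mu nu).
Proof.
rewrite /LM (largestP wo) mem_vsupp; split=> -[? h]; split=> // nu.
  by rewrite -mem_vsupp; apply: h.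
by rewrite mem_vsupp; apply: h.
Qed.

Lemma LM_exists v : v != 0 -> exists mu, LM gt v = Some mu.
Proof.
move=> /vcoef_neq0P[mu]; rewrite -mem_vsupp => muv.
by apply: (largest_exists wo); apply: contraTneq muv => ->.
Qed.

Lemma LM0 : LM gt (0 : 'rV[R]_k) = None.
Proof. by case E: (LM gt _) => [mu|//]; have /LMP[] := E; rewrite vcoef0 eqxx. Qed.

Lemma LT_LM v mu : LM gt v = Some mu -> LT gt v = vterm (vcoef v mu) mu.
Proof. by rewrite /LT => ->. Qed.

Lemma belowD v w mu : below v mu -> below w mu -> below (v + w) mu.
Proof.
move=> vb wb nu; rewrite vcoefD; have [v0|/vb//] := eqVneq (vcoef v nu) 0.
by rewrite v0 add0r; apply: wb.
Qed.

Lemma below0 mu : below 0 mu.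
Proof. by move=> nu; rewrite vcoef0 eqxx. Qed.

Lemma below_sum (I : eqType) (s : seq I) (F : I -> 'rV[R]_k) mu :
  (forall i, i \in s -> below (F i) mu) -> below (\sum_(i <- s) F i) mu.
Proof.
move=> Fb; rewrite big_seq.
by elim/big_ind: _ => [|v w|//]; [apply: below0|apply: belowD].
Qed.

Lemma below_trans v mu nu : gt nu mu -> below v mu -> below v nu.
Proof. by have [_ tr _ _] := wo => numu vb rho /vb; apply: tr. Qed.

Lemma below_LM v mu nu : LM gt v = Some mu -> gt nu mu -> below v nu.
Proof.
have [_ tr _ _] := wo => /LMP[_ vmax] numu rho /vmax/predU1P[->//|].
exact: tr.
Qed.

Lemma LM_vterm c mu : c != 0 -> LM gt (vterm c mu : 'rV[R]_k) = Some mu.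
Proof.
move=> c0; apply/LMP; split=> [|nu]; rewrite vcoef_vterm ?eqxx //.
by rewrite [nu == mu]eq_sym; case: (mu =P nu) => // _; rewrite mulr0n eqxx.
Qed.

Lemma LT_vterm c mu : c != 0 -> LT gt (vterm c mu : 'rV[R]_k) = vterm c mu.
Proof.
by move=> c0; rewrite (LT_LM (LM_vterm mu c0)) vcoef_vterm eqxx.
Qed.

Lemma below_vcoef v mu : below v mu -> vcoef v mu = 0.
Proof.
by have [irr _ _ _] := wo => vb; apply/eqP; apply: contraTT isT => /vb; rewrite irr.
Qed.

Lemma LM_addr_below v w mu :
  LM gt v = Some mu -> below w mu -> LM gt (v + w) = Some mu.
Proof.
move=> /LMP[vmu vmax] wb; apply/LMP; rewrite vcoefD (below_vcoef wb) addr0.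
split=> // nu; rewrite vcoefD; have [->|] := eqVneq (vcoef v nu) 0.
  by rewrite add0r => /wb->; rewrite orbT.
by move=> /vmax.
Qed.

Lemma LT_addr_below v w mu :
  LM gt v = Some mu -> below w mu -> LT gt (v + w) = LT gt v.
Proof.
move=> vmu wb; rewrite (LT_LM (LM_addr_below vmu wb)) (LT_LM vmu).
by rewrite vcoefD (below_vcoef wb) addr0.
Qed.

Lemma below_subLT v mu : LM gt v = Some mu -> below (v - LT gt v) mu.
Proof.
move=> vmu; have [_ vmax] := (LMP _ _).1 vmu; move=> nu; rewrite (LT_LM vmu).
rewrite vcoefD vcoefN vcoef_vterm; case: (eqVneq mu nu) => [->|munu].
  by rewrite subrr eqxx.
by rewrite subr0 => /vmax; rewrite eq_sym (negPf munu).
Qed.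

Hypothesis sc : shift_compatible gt.

(** Totality gives the converse of compatibility: the opposite comparison would be shifted as
    well. *)
Lemma mshiftP_gt a mu nu : gt (mshift a mu) (mshift a nu) = gt mu nu.
Proof.
have [irr _ tot _] := wo.
apply/idP/idP => [h|]; last exact: sc.
have [E|/tot/orP[//|/(sc a)]] := eqVneq mu nu; first by rewrite E irr in h.
by rewrite (well_order_asym wo h).
Qed.

Lemma LM_xmon_scale v mu a c :
  c != 0 -> LM gt v = Some mu ->
  LM gt ((c *: xmon K a) *: v) = Some (mshift a mu).
Proof.
move=> c0 /LMP[vmu vmax]; apply/LMP.
rewrite vcoef_xmon_scale !mulf_neq0 ?eps_neq0 //; split=> // nu.
case/vcoef_xmon_scale_neq0=> rho -> /vmax /predU1P[->|/(sc a)->].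
  by rewrite eqxx.
by rewrite orbT.
Qed.

Lemma LT_xmon_scale v a c :
  c != 0 -> LT gt ((c *: xmon K a) *: v) = (c *: xmon K a) *: LT gt v.
Proof.
move=> c0; have [->|/LM_exists[mu vmu]] := eqVneq v 0.
  by rewrite scaler0 /LT LM0 scaler0.
rewrite (LT_LM (LM_xmon_scale a c0 vmu)) (LT_LM vmu) scale_vterm.
by rewrite vcoef_xmon_scale -!mulrA [eps _ _ _ * _]mulrC.
Qed.

(* Along the component of LM(v), the order on N^k restricts to a total order
   on the exponents, for which LM(uv) is LM(u) LM(v). *)
Lemma LM_scale (u : R) v mu :
  u != 0 -> LM gt v = Some mu ->
  exists a, [/\ a \in msupp u, LM gt (u *: v) = Some (mshift a mu)
    & forall b, b \in msupp u -> b != a -> gt (mshift a mu) (mshift b mu)].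
Proof.
move=> u0 vmu; have [irr _ tot _] := wo.
have [|l lmax] := @largest_exists _ gt wo [seq mshift a mu | a <- msupp u].
  rewrite -size_eq0 size_map size_eq0; apply: contraNneq u0 => /msuppnil0 ->.
  by rewrite eqxx.
have /(largestP wo)[/mapP[a au lE] lge] := lmax; subst l.
have agt b : b \in msupp u -> b != a -> gt (mshift a mu) (mshift b mu).
  move=> bu ba; have /lge : mshift b mu \in [seq mshift a mu | a <- msupp u].
    exact: map_f.
  by rewrite xpair_eqE eqm_add2r (negPf ba).
exists a; split=> //.
have ua : u@_a != 0 by rewrite -mcoeff_msupp.
have tmu := LM_xmon_scale a ua vmu.
rewrite scale_sum_terms (bigD1_seq a) ?msupp_uniq //=.
set w := \sum_(_ <- _ | _) _.
have wb : below w (mshift a mu).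
  rewrite /w -big_filter; apply: below_sum => b; rewrite mem_filter => /andP[ba bu].
  have ub : u@_b != 0 by rewrite -mcoeff_msupp.
  by apply: (below_LM (LM_xmon_scale b ub vmu)); apply: agt.
exact: LM_addr_below tmu wb.
Qed.

End LeadMonomial.

(** * Left spans, lead modules and Groebner bases *)

Lemma lspan_sub (R : nzRingType) (V : lmodType R) (P M : V -> Prop) v :
  submodule M -> (forall w, P w -> M w) -> lspan P v -> M v.
Proof.
move=> [M0 MD] PM [l [lP ->]]; elim: l lP => [|x l IH] lP; first by rewrite big_nil.
rewrite big_cons; apply: MD; first by apply/PM/lP/mem_head.
by apply: IH => y yl; apply: lP; rewrite inE yl orbT.
Qed.

Lemma lspan_comb (R : nzRingType) (V : lmodType R) (G : seq V) (u : nat -> R) :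
  lspan (fun g => g \in G) (\sum_(i < size G) u i *: G`_i).
Proof.
exists [seq (u i, G`_i) | i <- iota 0 (size G)]; split=> [p /mapP[i]|].
  by rewrite mem_iota => iG -> /=; rewrite mem_nth.
by rewrite big_map -(big_mkord xpredT (fun i => u i *: G`_i)) /index_iota subn0.
Qed.

Lemma submoduleZ (R : nzRingType) (V : lmodType R) (M : V -> Prop) a v :
  submodule M -> M v -> M (a *: v).
Proof. by move=> [M0 MD] Mv; rewrite -[_ *: _]addr0; apply: MD. Qed.

Section GroebnerBasis.
Variables (n : nat) (K : fieldType) (k : nat) (gt : rel (vmon n k)).
Hypotheses (wo : well_order gt) (sc : shift_compatible gt).
Local Notation R := (skewpoly n K).
Implicit Types (v w p : 'rV[R]_k) (mu nu : vmon n k) (c : K).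

Lemma vcoef_sum_neq0 (I : eqType) (s : seq I) (F : I -> 'rV[R]_k) mu :
  vcoef (\sum_(i <- s) F i) mu != 0 ->
  exists2 i, i \in s & vcoef (F i) mu != 0.
Proof.
move=> nz; have [/hasP//|/hasPn F0] := boolP (has (fun i => vcoef (F i) mu != 0) s).
by case/eqP: nz; rewrite vcoef_sum big1_seq // => i /F0 /negPn/eqP.
Qed.

Lemma vcoef_scale_neq0 (u : R) v mu :
  vcoef (u *: v) mu != 0 ->
  exists a nu, [/\ a \in msupp u, mu = mshift a nu & vcoef v nu != 0].
Proof.
rewrite scale_sum_terms => /vcoef_sum_neq0[a au /vcoef_xmon_scale_neq0[nu]].
by exists a, nu.
Qed.

Lemma LM_neq0 v mu : LM gt v = Some mu -> v != 0.
Proof. by move=> vmu; apply/eqP=> v0; rewrite v0 LM0 in vmu. Qed.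

(** Some summand u_i g_i of a standard representation must contain mu; the bound by LM(p) then
    forces mu to be its lead monomial, a shift of LM(g_i). *)
Lemma grobner_LM_divides M (G : seq 'rV[R]_k) p mu :
  grobner_basis gt M G -> M p -> LM gt p = Some mu ->
  exists g nu a, [/\ g \in G, LM gt g = Some nu & mu = mshift a nu].
Proof.
have [irr tr _ _] := wo.
move=> [_ Grep] Mp pmu; have [u [pE uG]] := Grep p Mp.
have /(LMP wo)[+ _] := pmu; rewrite {1}pE => /vcoef_sum_neq0[i _ nz].
have uGi0 : u i *: G`_i != 0.
  by apply: contraNneq nz => ->; rewrite vcoef0.
have ui0 : u i != 0 by apply: contraNneq uGi0 => ->; rewrite scale0r.
have Gi0 : G`_i != 0 by apply: contraNneq uGi0 => ->; rewrite scaler0.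
have [nu Gnu] := LM_exists wo Gi0.
have [a [_ aE _]] := LM_scale wo sc ui0 Gnu.
exists G`_i, nu, a; split=> //; first exact: mem_nth.
have := uG i (ltn_ord i) uGi0; rewrite pmu aE /oge.
have /(LMP wo)[_ /(_ _ nz)] := aE.
case/predU1P=> [//|h1] /predU1P[//|h2].
by have := tr _ _ _ h1 h2; rewrite irr.
Qed.

(** The division algorithm supplies the representations: cancel the lead term of p by a multiple of
    g and recurse along the well-ordering. The induction bounds every monomial of each summand, not
    just the lead monomial, so that quotients can be added up. *)
Lemma grobner_basis_of_LM M (G : seq 'rV[R]_k) :
    submodule M -> (forall g, g \in G -> M g) ->
    (forall p mu, M p -> LM gt p = Some mu ->
       exists g nu a, [/\ g \in G, LM gt g = Some nu & mu = mshift a nu]) ->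
  grobner_basis gt M G.
Proof.
move=> sM GM Gdiv; have [_ tr _ wf] := wo.
have rep mu : forall p, M p -> LM gt p = Some mu -> exists u : nat -> R,
    p = \sum_(i < size G) u i *: G`_i /\
    (forall i nu, vcoef (u i *: G`_i) nu != 0 -> (nu == mu) || gt mu nu).
  elim/(well_founded_ind wf): mu => mu IH p Mp pmu.
  have [g [nu [a [gG gnu muE]]]] := Gdiv p mu Mp pmu.
  have /(LMP wo)[gnu0 _] := gnu; have /(LMP wo)[pmu0 _] := pmu.
  (* This c gives c x^a g the lead term of p; the sign comes from x^a times LM(g). *)
  pose c := vcoef p mu / (eps K a nu.1 * vcoef g nu).
  have c0 : c != 0 by rewrite mulf_neq0 ?invr_neq0 ?mulf_neq0 ?eps_neq0.
  set t := c *: xmon K a.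
  have tgmu : LM gt (t *: g) = Some mu by rewrite (LM_xmon_scale wo sc a c0 gnu) muE.
  have tgc : LT gt (t *: g) = LT gt p.
    rewrite (LT_LM tgmu) (LT_LM pmu) {1}muE vcoef_xmon_scale -mulrA.
    by rewrite divfK // mulf_neq0 ?eps_neq0.
  pose p' := p - t *: g.
  have pE : p = p' + t *: g by rewrite subrK.
  have Mp' : M p'.
    case: (sM) => _ MD; rewrite /p' addrC -scaleNr; apply: MD => //; exact: GM.
  have p'b : below gt p' mu.
    rewrite /p' -(subrK (LT gt p) p) -addrA -{2}tgc -[LT gt _ - _]opprB.
    apply: belowD; first exact: (below_subLT wo pmu).
    by move=> rho; rewrite vcoefN oppr_eq0; apply: (below_subLT wo tgmu).
  have [u [p'E ub]] : exists u : nat -> R, p' = \sum_(i < size G) u i *: G`_i /\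
      (forall i, below gt (u i *: G`_i) mu).
    have [p'0|/(LM_exists wo)[rho p'rho]] := eqVneq p' 0.
      exists (fun=> 0); split=> [|i]; last by rewrite scale0r; apply: below0.
      by rewrite p'0 big1 // => i _; rewrite scale0r.
    have murho : gt mu rho by have /(LMP wo)[/p'b] := p'rho.
    have [u [p'E ub]] := IH rho murho p' Mp' p'rho.
    by exists u; split=> // i nu' /ub /predU1P[->//|]; apply: tr.
  (* The list may repeat g; the new quotient goes to its first occurrence only. *)
  exists (fun i => if i == index g G then u i + t else u i); split.
    have gi : (index g G < size G)%N by rewrite index_mem.
    rewrite pE p'E (bigD1 (Ordinal gi)) //= [RHS](bigD1 (Ordinal gi)) //= eqxx.
    rewrite scalerDl nth_index // -!addrA; congr (_ + _); rewrite addrC; congr (_ + _).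
    by apply: eq_bigr => i; rewrite -val_eqE /= => /negPf->.
  move=> i nu'; case: (i =P index g G) => [->|_]; last by move/ub->; rewrite orbT.
  rewrite scalerDl vcoefD.
  have [->|nz] := eqVneq (vcoef (u (index g G) *: G`_(index g G)) nu') 0; last first.
    by rewrite (ub _ _ nz) orbT.
  by rewrite add0r nth_index //; have /(LMP wo)[_ h] := tgmu; apply: h.
have comb p : M p -> exists u : nat -> R, p = \sum_(i < size G) u i *: G`_i /\
     (forall i, (i < size G)%N -> u i *: G`_i != 0 ->
        oge gt (LM gt p) (LM gt (u i *: G`_i))).
  move=> Mp; have [p0|/(LM_exists wo)[mu pmu]] := eqVneq p 0.
    exists (fun=> 0); split=> [|i _]; last by rewrite scale0r eqxx.
    by rewrite p0 big1 // => i _; rewrite scale0r.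
  have [u [pE ub]] := rep mu p Mp pmu; exists u; split=> // i _.
  move=> /(LM_exists wo)[nu uGnu]; rewrite pmu uGnu /oge eq_sym.
  by apply: (ub i); have /(LMP wo)[] := uGnu.
split=> // p; split=> [/comb[u [-> _]]|]; first exact: lspan_comb.
exact: lspan_sub.
Qed.

Lemma lead_module_LM (M : 'rV[R]_k -> Prop) p mu :
  M p -> LM gt p = Some mu -> lead_module gt M (vterm 1 mu).
Proof.
move=> Mp pmu; exists [:: (1, vterm 1 mu)]; split=> [q|].
  rewrite mem_seq1 => /eqP->; exists p, mu; split=> //; exact: LM_neq0 pmu.
by rewrite big_seq1 scale1r.
Qed.

(** Reading the coefficient at mu in the combination shows that mu is a shift of one of the
    generating lead monomials; the same shift of the element behind it has lead monomial mu. *)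
Lemma lead_module_vterm (M : 'rV[R]_k -> Prop) c mu :
  submodule M -> c != 0 -> lead_module gt M (vterm c mu) ->
  exists2 p, M p & LM gt p = Some mu.
Proof.
move=> sM c0 [l [lP E]].
have : vcoef (vterm c mu : 'rV[R]_k) mu != 0 by rewrite vcoef_vterm eqxx.
rewrite E => /vcoef_sum_neq0[q /lP[p [nu [Mp _ pnu ->]]]].
case/vcoef_scale_neq0=> a [rho [_ -> ]]; rewrite vcoef_vterm.
case: (nu =P rho) => [<- _|_]; last by rewrite eqxx.
exists ((1 *: xmon K a) *: p); first exact: submoduleZ.
by rewrite (LM_xmon_scale wo sc a (oner_neq0 K) pnu).
Qed.

End GroebnerBasis.

Lemma mdividesP n k (nu mu : vmon n k) :
  reflect (exists a, mu = mshift a nu) (mdivides (Some nu) (Some mu)).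
Proof.
case: nu mu => b i [d j]; rewrite /mdivides /mshift /=.
apply: (iffP andP) => [[/eqP-> bd]|[a [-> ->]]]; last by rewrite lem_addl.
by exists (d - b)%MM; rewrite submK.
Qed.

Lemma mshiftD n k a b (mu : vmon n k) : mshift a (mshift b mu) = mshift (a + b) mu.
Proof. by rewrite /mshift addmA. Qed.

(** * The Schreyer ordering and the map phi *)

Section Schreyer.
Variables (n : nat) (K : fieldType) (m r : nat) (gt : rel (vmon n m)).
Variable G : r.-tuple 'rV[skewpoly n K]_m.
Local Notation R := (skewpoly n K).
Local Notation f := (tnth G).
Local Notation sgt := (schreyer gt G).
Variable lm : 'I_r -> vmon n m.
Hypotheses (wo : well_order gt) (sc : shift_compatible gt).
Hypothesis lmE : forall i, LM gt (f i) = Some (lm i).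
Implicit Types (v w : 'rV[R]_r) (s : vmon n r) (c d : K) (a : 'X_{1..n}).

(** The lead monomial of phi(x^a e_i). The Schreyer ordering compares these first, and the recursion
    of LiftSubtree descends along them. *)
Definition smon s : vmon n m := mshift s.1 (lm s.2).

Lemma smon_mshift a s : smon (mshift a s) = mshift a (smon s).
Proof. by rewrite /smon mshiftD. Qed.

Lemma LM_xmon_tnth c s :
  c != 0 -> LM gt ((c *: xmon K s.1) *: f s.2) = Some (smon s).
Proof. by move=> c0; apply: LM_xmon_scale. Qed.

Lemma schreyerE s t :
  sgt s t = gt (smon s) (smon t) || ((smon s == smon t) && (s.2 < t.2)%N).
Proof.
by rewrite /schreyer -[xmon K s.1]scale1r -[xmon K t.1]scale1r
  !LM_xmon_tnth ?oner_neq0.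
Qed.

Lemma schreyer_shift : shift_compatible sgt.
Proof.
move=> a s t; rewrite !schreyerE !smon_mshift mshiftP_gt // => /orP[->//|].
by case/andP=> /eqP-> ->; rewrite eqxx orbT.
Qed.

(** This is the lexicographic product of the well-ordering on images with the reversed ordering of
    finitely many indices; image and index determine the monomial because addition of exponents is
    cancellative. *)
Lemma schreyer_well_order : well_order sgt.
Proof.
have [irr tr tot wf] := wo; split.
- by move=> s; rewrite schreyerE irr ltnn andbF.
- move=> s t u; rewrite !schreyerE => /orP[ts|/andP[/eqP<- ts]].
    move=> /orP[su|/andP[/eqP<- _]]; last by rewrite ts.
    by rewrite (tr _ _ _ ts su).
  move=> /orP[->//|/andP[-> su]]; by rewrite (ltn_trans ts su) orbT.
- move=> s t st; rewrite !schreyerE [smon t == _]eq_sym.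
  have [E|/tot/orP[]->//] := eqVneq (smon s) (smon t); last by rewrite orbT.
  rewrite E irr /=; case: (ltngtP s.2 t.2) => // i12.
  have i12' : s.2 = t.2 by apply: val_inj.
  case/eqP: st; rewrite (surjective_pairing s) (surjective_pairing t).
  by move: E; rewrite /smon /mshift i12' => /(congr1 fst)/eqP; rewrite eqm_add2r => /eqP->.
move=> s; move: {2}(smon s) (erefl (smon s)) => mu.
elim/(well_founded_ind wf): mu s => mu IH s.
(* Descent at a fixed image raises the index, so the inner induction is on a bound N for r - s.2; N
   = 0 is impossible because s.2 < r. *)
move: {2}(r - s.2)%N (leqnn (r - s.2)%N) => N.
elim: N s => [|N IHN] s; rewrite leqNgt.
  by rewrite subn_gt0 ltn_ord.
rewrite -leqNgt => sN smu; constructor => t; rewrite schreyerE smu.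
case/orP=> [mut|/andP[/eqP tmu st]]; first exact: (IH _ mut).
by apply: IHN; rewrite // -ltnS; apply: leq_trans sN; rewrite ltn_sub2l.
Qed.

Lemma phiP u v w : phi G (u *: v + w) = u *: phi G v + phi G w.
Proof.
rewrite /phi scaler_sumr -big_split; apply: eq_bigr => i _ /=.
by rewrite !mxE scalerDl scalerA.
Qed.

Lemma phi0 : phi G 0 = 0.
Proof. by rewrite /phi big1 // => i _; rewrite mxE scale0r. Qed.

Lemma phiD v w : phi G (v + w) = phi G v + phi G w.
Proof. by have := phiP 1 v w; rewrite !scale1r. Qed.

Lemma phi_sum (I : Type) (s : seq I) (F : I -> 'rV[R]_r) :
  phi G (\sum_(i <- s) F i) = \sum_(i <- s) phi G (F i).
Proof. exact: (big_morph (phi G) phiD phi0). Qed.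

Lemma phi_vterm c s : phi G (vterm c s) = (c *: xmon K s.1) *: f s.2.
Proof.
rewrite /phi (bigD1 s.2) //= big1 ?addr0 => [|i is2].
  by rewrite !mxE !eqxx mulr1.
by rewrite !mxE (negPf is2) andbF mulr0 scale0r.
Qed.

Lemma Syz_submodule : submodule (Syz G).
Proof.
by split=> [|u v w]; rewrite /Syz ?phi0 // phiP => -> ->; rewrite scaler0 addr0.
Qed.

Lemma below_phi v mu :
  (forall t, vcoef v t != 0 -> gt mu (smon t)) -> below gt (phi G v) mu.
Proof.
move=> vb; rewrite -[v]sum_vterms phi_sum; apply: below_sum => t /vtermsP[s vs ->].
rewrite phi_vterm; exact: (below_LM wo (LM_xmon_tnth s vs) (vb s vs)).
Qed.

(** * Reducible monomials and lower order terms *)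

Definition divisible (nu : vmon n m) : bool :=
  [exists i, mdivides (Some (lm i)) (Some nu)].

Lemma divisibleP nu : reflect (exists s, smon s = nu) (divisible nu).
Proof.
apply: (iffP existsP) => [[i /mdividesP[a ->]]|[[a i] <-]]; first by exists (a, i).
by exists i; apply/mdividesP; exists a.
Qed.

Lemma lower_order_vterm c nu :
  c != 0 -> lower_order gt G (vterm c nu) = ~~ divisible nu.
Proof.
move=> c0; rewrite /lower_order (LM_vterm wo nu c0) negb_exists.
apply/allP/forallP => [h i|h g /tnthP[i ->]]; rewrite ?lmE //.
by rewrite -lmE h // mem_tnth.
Qed.

Lemma vcoef_LOT (g : 'rV[R]_m) nu : vcoef (LOT gt G g) nu = if divisible nu then 0 else vcoef g nu.
Proof.
rewrite /LOT big_map vcoef_sum -big_filter.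
rewrite (eq_in_filter (a2 := fun mu => ~~ divisible mu)) => [|mu]; last first.
  by rewrite mem_vsupp => /lower_order_vterm->.
rewrite big_filter; have [dnu|dnu] := boolP (divisible nu).
  apply: big1 => mu dmu; rewrite vcoef_vterm; case: (mu =P nu) => // E.
  by rewrite E dnu in dmu.
rewrite -[in RHS](sum_vterms g) big_map vcoef_sum.
rewrite [RHS](bigID (fun mu => divisible mu)) /= [X in _ = X + _]big1 ?add0r //.
move=> mu dmu; rewrite vcoef_vterm; case: (mu =P nu) => // E.
by rewrite -E dmu in dnu.
Qed.

(** The coefficientwise form of [sum_of_lower_order], which survives cancellation in sums. *)
Definition all_lower (v : 'rV[R]_m) : Prop :=
  forall nu, vcoef v nu != 0 -> ~~ divisible nu.

Lemma all_lowerD (v w : 'rV[R]_m) : all_lower v -> all_lower w -> all_lower (v + w).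
Proof.
move=> vl wl nu; rewrite vcoefD; have [->|/vl//] := eqVneq (vcoef v nu) 0.
by rewrite add0r; apply: wl.
Qed.

Lemma all_lower_sum (I : eqType) (s : seq I) (F : I -> 'rV[R]_m) :
  (forall i, i \in s -> all_lower (F i)) -> all_lower (\sum_(i <- s) F i).
Proof.
move=> Fb; rewrite big_seq.
elim/big_ind: _ => [nu|g h|//]; [by rewrite vcoef0 eqxx|exact: all_lowerD].
Qed.

Lemma all_lower_LOT (g : 'rV[R]_m) : all_lower (LOT gt G g).
Proof. by move=> nu; rewrite vcoef_LOT; case: divisible => //; rewrite eqxx. Qed.

Lemma sum_of_lower_orderP (v : 'rV[R]_m) : all_lower v -> sum_of_lower_order gt G v.
Proof.
move=> vl; exists (vterms v); split=> [t /vtermsP[mu vmu ->]|]; last by rewrite sum_vterms.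
by split; [exists (vcoef v mu), mu | rewrite lower_order_vterm // vl].
Qed.

Lemma vterms_subLOT (g t : 'rV[R]_m) :
  t \in vterms (g - LOT gt G g) ->
  exists nu, [/\ vcoef g nu != 0, divisible nu & t = vterm (vcoef g nu) nu].
Proof.
case/vtermsP=> nu; rewrite vcoefD vcoefN vcoef_LOT.
case: ifP => [dnu|_]; last by rewrite subrr eqxx.
by rewrite subr0 => gnu ->; exists nu.
Qed.

(** The coefficient is that of [lquot]: divide c by the lead coefficient of the generator and by the
    sign of the product of the two monomials. *)
Lemma subtree_choice_exists c s :
  c != 0 -> exists2 u, subtree_choice gt G (vterm c (smon s)) u s.2 &
    exists2 d, d != 0 & u = d *: xmon K s.1.
Proof.
move=> c0; set k := vcoef (f s.2) (lm s.2); set e := eps K s.1 (lm s.2).1.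
have k0 : k != 0 by have /(LMP wo)[] := lmE s.2.
have d0 : c / (k * e) != 0 by rewrite !mulf_neq0 ?invr_neq0 ?mulf_neq0 ?eps_neq0.
exists ((c / (k * e)) *: xmon K s.1); last by exists (c / (k * e)).
split; first by exists (c / (k * e)), s.1.
by rewrite (LT_LM (lmE _)) scale_vterm -mulrA divfK // mulf_neq0 ?eps_neq0.
Qed.

Lemma subtree_choice_inv c nu u (i : 'I_r) :
  subtree_choice gt G (vterm c nu) u i ->
  exists d a, [/\ d != 0, u = d *: xmon K a & smon (a, i) = nu].
Proof.
case=> -[d [a [d0 ->]]]; rewrite (LT_LM (lmE _)) scale_vterm => E.
exists d, a; split=> //; have [|_ <-//] := vterm_inj _ E.
by rewrite !mulf_neq0 ?eps_neq0 //; have /(LMP wo)[] := lmE i.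
Qed.

(** * Executions of LiftSubtree *)

Let swo := schreyer_well_order.
Let ssc := schreyer_shift.

Lemma schreyer_gt s t : gt (smon s) (smon t) -> sgt s t.
Proof. by rewrite schreyerE => ->. Qed.

Lemma LM_phi_vterm c s : c != 0 -> LM gt (phi G (vterm c s)) = Some (smon s).
Proof. by rewrite phi_vterm; apply: LM_xmon_tnth. Qed.

Lemma LT_phi_vtermN c s :
  c != 0 -> LT gt (phi G (vterm (- c) s)) = - LT gt (phi G (vterm c s)).
Proof.
by move=> c0; rewrite !phi_vterm !LT_xmon_scale ?oppr_eq0 // !scaleNr.
Qed.

Lemma subtree_choice_term d nu u (i : 'I_r) :
  subtree_choice gt G (vterm d nu) u i ->
  exists c s, [/\ c != 0, u *: basis_vec n K i = vterm c s, smon s = nu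
    & LT gt (phi G (vterm c s)) = vterm d nu].
Proof.
move=> ch; have [c [a [c0 uE smu]]] := subtree_choice_inv ch.
exists c, (a, i); split=> //; first by rewrite uE xmon_basis_vec.
by rewrite phi_vterm LT_xmon_scale // -uE; case: ch.
Qed.

Lemma subtree_todoP c s t :
  c != 0 -> t \in subtree_todo gt G (vterm c s) ->
  exists d s', [/\ d != 0, t = vterm d (smon s') & gt (smon s) (smon s')].
Proof.
move=> c0 /vterms_subLOT[nu [g0 /divisibleP[s' s'nu] ->]].
exists (vcoef (phi G (vterm c s) - LT gt (phi G (vterm c s))) nu), s'.
rewrite s'nu; split=> //; exact: (below_subLT wo (LM_phi_vterm s c0) g0).
Qed.

(** This holds for an arbitrary admissible choice: matching t fixes both the lead term and the image
    of the call, and t lies below LT(phi s), which was removed before T was formed. *)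
Lemma subtree_callP c s t u (i : 'I_r) :
  c != 0 -> t \in subtree_todo gt G (vterm c s) -> subtree_choice gt G t u i ->
  exists d s', [/\ d != 0, - (u *: basis_vec n K i) = vterm d s',
    LT gt (phi G (vterm d s')) = - t & gt (smon s) (smon s')].
Proof.
move=> c0 /(subtree_todoP c0)[d [s1 [d0 -> gts]]] /subtree_choice_term.
case=> d' [s' [d'0 uE s's ltE]]; exists (- d'), s'; split=> //.
- by rewrite oppr_eq0.
- by rewrite -vtermN -uE.
- by rewrite LT_phi_vtermN // ltE.
by rewrite s's.
Qed.

Lemma LiftSubtree_terminates_vterm c s :
  c != 0 -> LiftSubtree_terminates gt G (vterm c s).
Proof.
have [_ _ _ wf] := wo.
move: {2}(smon s) (erefl (smon s)) => mu.
elim/(well_founded_ind wf): mu c s => mu IH c s smu c0; constructor.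
  move=> t /(subtree_todoP c0)[d [s' [d0 -> _]]].
  by have [u uP _] := subtree_choice_exists s' d0; exists u, s'.2.
move=> t u i tT /(subtree_callP c0 tT)[d [s' [d0 -> _ ss']]].
by apply: IH d0; last reflexivity; rewrite -smu.
Qed.

(** Correctness quantifies over executions and would be vacuous without one; the descent that proves
    termination also builds one. *)
Lemma LiftSubtree_exists c s :
  c != 0 -> exists sbar, LiftSubtree gt G (vterm c s) sbar.
Proof.
have [_ _ _ wf] := wo.
move: {2}(smon s) (erefl (smon s)) => mu.
elim/(well_founded_ind wf): mu c s => mu IH c s smu c0.
(* The choice (u, i) and the result of the recursive call are bundled, so that one finite choice
   over T yields all three functions of an execution. *)
pose P t (x : R * 'I_r * 'rV[R]_r) := subtree_choice gt G t x.1.1 x.1.2 /\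
  LiftSubtree gt G (- (x.1.1 *: basis_vec n K x.1.2)) x.2.
have [t tT|F FP] := @seq_choice _ _ P (subtree_todo gt G (vterm c s)) (0, s.2, 0).
  have [d [s' [d0 tE _]]] := subtree_todoP c0 tT.
  have [u uP _] := subtree_choice_exists s' d0; rewrite -tE in uP.
  have [d1 [s1 [d10 callE _ ss1]]] := subtree_callP c0 tT uP.
  have [|ret retP] := IH (smon s1) _ d1 s1 erefl d10; first by rewrite -smu.
  by exists (u, s'.2, ret); split=> //; rewrite /= callE.
exists (vterm c s + \sum_(t <- subtree_todo gt G (vterm c s)) (F t).2).
by apply: (LiftSubtree_run (u := fun t => (F t).1.1) (i := fun t => (F t).1.2)
   (ret := fun t => (F t).2)) => t /FP[].
Qed.

(* The returned vectors cancel the terms t \in T up to the summands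
   phi(ret t) + t, which will be sums of lower order terms. *)
Lemma sub_todo (g : 'rV[R]_m) (ret : 'rV[R]_m -> 'rV[R]_r) :
  g + \sum_(t <- vterms (g - LOT gt G g)) phi G (ret t) =
  LOT gt G g + \sum_(t <- vterms (g - LOT gt G g)) (phi G (ret t) + t).
Proof.
by rewrite big_split /= sum_vterms addrCA [LOT gt G g + _]addrC subrK addrC.
Qed.

(** A subtree lifting alone is too weak for the induction. The reference point is LT(phi s), known
    before the run; for the call on t it equals -t, so that phi(ret t) + t is the remainder to
    control. The bound on sbar - s keeps all added terms below s in the Schreyer ordering. *)
Lemma LiftSubtree_spec (s sbar : 'rV[R]_r) :
  LiftSubtree gt G s sbar -> forall c mu, c != 0 -> s = vterm c mu ->
  [/\ below sgt (sbar - s) mu,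
      below gt (phi G sbar - LT gt (phi G s)) (smon mu)
    & all_lower (phi G sbar - LT gt (phi G s))].
Proof.
elim=> {s sbar} s u i ret ch _ IH c mu c0 sE; subst s.
set s := vterm c mu in ch IH *.
have call t : t \in subtree_todo gt G s -> exists2 nu, gt (smon mu) (smon nu) &
    [/\ below sgt (ret t) mu, below gt (phi G (ret t) + t) (smon mu)
      & all_lower (phi G (ret t) + t)].
  move=> tT; have [d [s' [d0 callE ltE gts]]] := subtree_callP c0 tT (ch t tT).
  exists s' => //; have [b1 b2 b3] := IH t tT d s' d0 callE.
  (* Subtracting the lead term -t of the image of the call amounts to adding t. *)
  rewrite callE ltE opprK in b1 b2 b3; split=> //; last exact: below_trans gts b2.
  have mus' := schreyer_gt gts.
  rewrite -[ret t](subrK (vterm d s')); apply: belowD.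
    exact: (below_trans swo mus' b1).
  exact: (below_LM swo (LM_vterm swo s' d0) mus').
pose g := phi G s - LT gt (phi G s).
have sbarE : phi G (s + \sum_(t <- subtree_todo gt G s) ret t) - LT gt (phi G s) =
    LOT gt G g + \sum_(t <- subtree_todo gt G s) (phi G (ret t) + t).
  by rewrite -sub_todo phiD phi_sum addrAC.
have gb : below gt g (smon mu) by exact: (below_subLT wo (LM_phi_vterm mu c0)).
rewrite sbarE addrC addKr; split.
- by apply: below_sum => t /call[? _ []].
- apply: belowD => [nu|]; last by apply: below_sum => t /call[? _ []].
  by rewrite vcoef_LOT; case: divisible => [|/gb//]; rewrite eqxx.
apply: all_lowerD; first exact: all_lower_LOT.
by apply: all_lower_sum => t /call[? _ []].
Qed.

Lemma LiftSubtree_lifting c s sbar :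
  c != 0 -> LiftSubtree gt G (vterm c s) sbar ->
  is_subtree_lifting gt G (vterm c s) sbar.
Proof.
move=> c0 run; have [b1 b2 b3] := LiftSubtree_spec run c0 erefl.
have E : LT gt (phi G sbar) = LT gt (phi G (vterm c s)).
  have lmv := LM_phi_vterm s c0.
  rewrite -[phi G sbar](subrK (LT gt (phi G (vterm c s)))) addrC.
  have ltv : LM gt (LT gt (phi G (vterm c s))) = Some (smon s).
    by rewrite (LT_LM lmv) LM_vterm //; case/(LMP wo): lmv.
  rewrite (LT_addr_below wo ltv b2) (LT_LM lmv) LT_vterm //.
  by case/(LMP wo): lmv.
split; last by rewrite E; apply: sum_of_lower_orderP.
rewrite -[sbar](subrK (vterm c s)) addrC (LT_addr_below swo (LM_vterm swo s c0) b1).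
exact: LT_vterm.
Qed.

(** * Standard representations and cancellation in syzygies *)

Variable M : 'rV[R]_m -> Prop.
Hypothesis gb : grobner_basis gt M G.

Lemma phi_mem v : M (phi G v).
Proof.
case: gb => gen _; apply/gen.
exists [seq (v 0 i, f i) | i <- index_enum 'I_r]; split=> [p /mapP[i _ ->]|].
  exact: mem_tnth.
by rewrite big_map.
Qed.

Lemma all_lower_eq0 (v : 'rV[R]_m) : M v -> all_lower v -> v = 0.
Proof.
move=> Mv vl; apply/eqP; apply: contraT => /(LM_exists wo)[mu vmu].
have [g [nu [a [/tnthP[i ->]]]]] := grobner_LM_divides wo sc gb Mv vmu.
rewrite lmE => -[<-] muE; have /(LMP wo)[/vl/negP[]] := vmu.
by apply/divisibleP; exists (a, i).
Qed.

(** The coefficients of a standard representation of q form w. The bound on LM(u_i f_i) passes to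
    every term of u_i, since the shifts of LM(f_i) by the exponents of u_i are dominated by LM(u_i
    f_i). *)
Lemma grobner_below_phi (q : 'rV[R]_m) mu :
  M q -> below gt q mu ->
  exists2 w, phi G w = q & forall t, vcoef w t != 0 -> gt mu (smon t).
Proof.
have [irr tr _ _] := wo.
move=> Mq qb; case: (gb) => _ /(_ q Mq)[u [qE ub]].
exists (\row_(i < r) u i); first rewrite qE.
  rewrite -(big_mkord xpredT (fun i => u i *: G`_i)) size_tuple big_mkord.
  by apply: eq_bigr => i _; rewrite mxE (tnth_nth 0).
move=> [a i]; rewrite /vcoef mxE /= -mcoeff_msupp => au.
have ui0 : u i != 0 by apply: contraTneq au => ->; rewrite msupp0.
have [b [_ bE bmax]] := LM_scale wo sc ui0 (lmE i).
have := ub i; rewrite size_tuple ltn_ord -tnth_nth => /(_ isT).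
rewrite bE (LM_neq0 wo bE) => /(_ isT).
(* For q = 0 the comparison with [None] is false, so no u_i f_i is nonzero and nothing is left to
   bound. *)
case qmu: (LM gt q) => [nu|] //=; have /(LMP wo)[/qb mnu _] := qmu => nub.
have mub : gt mu (mshift b (lm i)) by case/predU1P: nub => [<-//|]; apply: tr.
have [->//|/(bmax _ au)] := eqVneq a b; exact: tr.
Qed.

(* Under phi the lead term of v can only cancel against a term with the same
   image, which by the Schreyer ordering has a larger index. *)
Lemma Syz_LM_partner v s :
  Syz G v -> LM sgt v = Some s ->
  exists2 t, smon t = smon s & (s.2 < t.2)%N.
Proof.
move=> Sv vs; have [v0 _] := (LMP swo _ _).1 vs.
have [/hasP[t _ /andP[/eqP ts st]]|/hasPn none] :=
    boolP (has (fun t => (smon t == smon s) && (s.2 < t.2)%N) (vsupp v)).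
  by exists t.
have wb : below gt (phi G (v - LT sgt v)) (smon s).
  apply: below_phi => t vt; have := below_subLT swo vs vt; rewrite schreyerE.
  case/orP=> // /andP[/eqP st s2].
  suff /none : t \in vsupp v by rewrite st s2 eqxx.
  rewrite mem_vsupp; apply: contraNneq vt => vt0.
  rewrite vcoefD vt0 add0r vcoefN (LT_LM vs) vcoef_vterm.
  by case: (s =P t) => [E|_]; [rewrite E ltnn in s2|rewrite oppr0].
have := LM_addr_below wo (LM_phi_vterm s v0) wb.
by rewrite -(LT_LM vs) -phiD addrC subrK Sv LM0.
Qed.

(** Here T may contain the lead term of phi(s). That term needs a preimage of larger index, provided
    by the syzygy v; every other t has a smaller image, so any preimage is Schreyer-smaller. *)
Lemma tree_todoP v c s t :
  Syz G v -> LM sgt v = Some s -> c != 0 -> t \in tree_todo gt G (vterm c s) ->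
  exists d s', [/\ d != 0, t = vterm d (smon s') & sgt s s'].
Proof.
move=> Sv vs c0 /vterms_subLOT[nu [g0 /divisibleP[s' s'nu] ->]].
set d := vcoef _ _; have /(LMP wo)[_ /(_ nu g0)/predU1P[nuE|gts]] := LM_phi_vterm s c0.
  have [s1 s1s lts] := Syz_LM_partner Sv vs.
  by exists d, s1; rewrite s1s nuE schreyerE s1s eqxx lts orbT.
by exists d, s'; rewrite s'nu; split=> //; apply: schreyer_gt; rewrite s'nu.
Qed.

(** * Executions of LiftTree on lead terms of syzygies *)

Section LiftTree.
Variables (v : 'rV[R]_r) (c : K) (s : vmon n r).
Hypotheses (Sv : Syz G v) (vs : LM sgt v = Some s) (c0 : c != 0).

Lemma tree_choice_exists t :
  t \in tree_todo gt G (vterm c s) ->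
  exists u i, tree_choice gt G (vterm c s) t u i.
Proof.
case/(tree_todoP Sv vs c0)=> d [s' [d0 -> ss']].
have [u uP [d' d'0 uE]] := subtree_choice_exists s' d0; exists u, s'.2; split=> //.
rewrite (LM_vterm swo s c0) uE xmon_basis_vec -surjective_pairing.
by rewrite (LM_vterm swo s' d'0).
Qed.

Lemma tree_callP t u (i : 'I_r) :
  t \in tree_todo gt G (vterm c s) -> tree_choice gt G (vterm c s) t u i ->
  exists d s', [/\ d != 0, - (u *: basis_vec n K i) = vterm d s',
    LT gt (phi G (vterm d s')) = - t & sgt s s'].
Proof.
move=> /(tree_todoP Sv vs c0)[d [s1 [d0 -> _]]] [/subtree_choice_term].
case=> d' [s' [d'0 uE _ ltE]]; rewrite uE !(LM_vterm swo) // => ss'.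
exists (- d'), s'; split=> //.
- by rewrite oppr_eq0.
- by rewrite -vtermN -uE.
by rewrite LT_phi_vtermN // ltE.
Qed.

Lemma LiftTree_terminates_vterm : LiftTree_terminates gt G (vterm c s).
Proof.
split=> [t|t u i tT]; first exact: tree_choice_exists.
by case/(tree_callP tT)=> d [s' [d0 -> _ _]]; apply: LiftSubtree_terminates_vterm.
Qed.

Lemma LiftTree_exists : exists sbar, LiftTree gt G (vterm c s) sbar.
Proof.
pose P t (x : R * 'I_r * 'rV[R]_r) := tree_choice gt G (vterm c s) t x.1.1 x.1.2 /\
  LiftSubtree gt G (- (x.1.1 *: basis_vec n K x.1.2)) x.2.
have [t tT|F FP] := @seq_choice _ _ P (tree_todo gt G (vterm c s)) (0, s.2, 0).
  have [u [i ch]] := tree_choice_exists tT.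
  have [d [s' [d0 callE _ _]]] := tree_callP tT ch.
  have [ret retP] := LiftSubtree_exists s' d0.
  by exists (u, i, ret); split=> //; rewrite /= callE.
exists (vterm c s + \sum_(t <- tree_todo gt G (vterm c s)) (F t).2).
exists (fun t => (F t).1.1), (fun t => (F t).1.2), (fun t => (F t).2).
by split=> // t /FP[].
Qed.

Lemma LiftTree_lift sbar :
  LiftTree gt G (vterm c s) sbar -> is_lift gt G (vterm c s) sbar.
Proof.
move=> [u [i [ret [ch rec sbarE]]]].
have call t : t \in tree_todo gt G (vterm c s) ->
    below sgt (ret t) s /\ all_lower (phi G (ret t) + t).
  move=> tT; have [d [s' [d0 callE ltE ss']]] := tree_callP tT (ch t tT).
  have := rec t tT; rewrite callE => run.
  have [b1 _ b3] := LiftSubtree_spec run d0 erefl.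
  rewrite ltE opprK in b3; split=> //.
  rewrite -[ret t](subrK (vterm d s')); apply: belowD.
    exact: (below_trans swo ss' b1).
  exact: (below_LM swo (LM_vterm swo s' d0) ss').
rewrite sbarE; split.
  apply: all_lower_eq0; first exact: phi_mem.
  rewrite phiD phi_sum sub_todo; apply: all_lowerD; first exact: all_lower_LOT.
  by apply: all_lower_sum => t /call[].
rewrite (LT_addr_below swo (LM_vterm swo s c0)) ?LT_vterm //.
by apply: below_sum => t /call[].
Qed.

End LiftTree.

(** * Pairs of generators and lead monomials of syzygies *)

Definition pair_lcm (i j : 'I_r) : 'X_{1..n} :=
  [multinom maxn ((lm j).1 l) ((lm i).1 l) | l < n].

(** Equality of components says that the least common multiple is nonzero, and the scalar in [lquot]
    is a unit, so only the quotient of exponents is seen. *)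
Lemma mji_monomial (i j : 'I_r) :
  (i < j)%N -> (lm j).2 = (lm i).2 ->
  (i, j) \in lead_pairs gt G /\
  LM sgt (mji gt G j i *: basis_vec n K i) = Some ((pair_lcm i j - (lm i).1)%MM, i).
Proof.
move=> ij ji.
have lcmE : Defs.mlcm (LM gt (f j)) (LM gt (f i)) = Some (pair_lcm i j, (lm j).2).
  rewrite !lmE /Defs.mlcm /pair_lcm.
  by move: ji; case: (lm i) (lm j) => [b k] [b' k'] /= ->; rewrite eqxx.
split; first by rewrite mem_filter mem_enum /= ij lcmE.
have ltE := LT_LM (lmE i); have /(LMP wo)[k0 _] := lmE i.
rewrite /mji lcmE /lquot (LM_vterm wo) ?oner_neq0 // ltE (LM_vterm wo) //=.
rewrite xmon_basis_vec (LM_vterm swo) // !vcoef_vterm !eqxx.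
by rewrite !mulf_neq0 ?invr_neq0 ?mulf_neq0 ?eps_neq0 ?oner_neq0.
Qed.

Lemma lead_pairsP (p : 'I_r * 'I_r) :
  p \in lead_pairs gt G -> (p.1 < p.2)%N /\ (lm p.2).2 = (lm p.1).2.
Proof.
rewrite mem_filter => /andP[/andP[-> +] _]; rewrite !lmE /Defs.mlcm.
by case: (lm p.1) (lm p.2) => [b k] [b1 k1] /=; case: (k1 =P k).
Qed.

Lemma smon_pair_lcm (i j l : 'I_r) : l \in [:: i; j] -> (lm j).2 = (lm i).2 ->
  smon ((pair_lcm i j - (lm l).1)%MM, l) = (pair_lcm i j, (lm i).2).
Proof.
rewrite !inE => /orP[]/eqP-> ji; rewrite /smon /mshift /= submK ?ji //;
  apply/mnm_lepP => q; rewrite mnmE ?leq_maxl ?leq_maxr //.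
Qed.

Definition pair_lead (p : 'I_r * 'I_r) s : Prop :=
  p \in lead_pairs gt G /\
  LM sgt (mji gt G p.2 p.1 *: basis_vec n K p.1) = Some s.

(** The S-vector of f_i and f_j has image below the common multiple and lies in M, so a standard
    representation w corrects it to a syzygy. The term at e_j is smaller than s by its index, the
    terms of w by their images. *)
Lemma pair_lead_syz p s :
  pair_lead p s -> exists2 v, Syz G v & LM sgt v = Some s.
Proof.
case: p => i j [/lead_pairsP/= [ij ji] ms].
have [_ ms'] := mji_monomial ij ji; rewrite ms' in ms; case: ms => {ms'} sE.
pose s' := ((pair_lcm i j - (lm j).1)%MM, j).
have ss' : smon s' = smon s.
  by rewrite -sE !smon_pair_lcm // !inE eqxx ?orbT.
have s1 := LM_phi_vterm s (oner_neq0 K).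
pose k := vcoef (phi G (vterm 1 s)) (smon s).
have k0 : k != 0 by have /(LMP wo)[] := s1.
(* The coefficient d is chosen so that both halves of the S-vector have images with the same lead
   term. *)
have [u [_ uE] [d d0 ud]] := subtree_choice_exists s' k0.
have dE : LT gt (phi G (vterm d s')) = LT gt (phi G (vterm 1 s)).
  by rewrite phi_vterm LT_xmon_scale // -ud uE ss' (LT_LM s1).
have s'1 := LM_phi_vterm s' d0.
pose q := phi G (vterm 1 s - vterm d s').
have qb : below gt q (smon s).
  rewrite /q vtermN phiD -(subrK (LT gt (phi G (vterm 1 s))) (phi G (vterm 1 s))).
  rewrite -addrA; apply: belowD; first exact: (below_subLT wo s1).
  rewrite -dE addrC -[LT gt _]opprK -(LT_phi_vtermN s' d0) -ss'.
  by apply: (below_subLT wo); apply: LM_phi_vterm; rewrite oppr_eq0.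
have [w wq wb] := grobner_below_phi (phi_mem _) qb.
exists (vterm 1 s + (- vterm d s' - w)).
  rewrite /Syz addrA -[- w]scaleN1r addrC phiP wq scaleN1r; exact: addNr.
apply: (LM_addr_below swo (LM_vterm swo s (oner_neq0 K))); apply: belowD.
  rewrite vtermN; apply: (below_LM swo (LM_vterm swo s' _)); first by rewrite oppr_eq0.
  by rewrite schreyerE ss' eqxx -sE ij orbT.
by move=> t; rewrite vcoefN oppr_eq0 => /wb; apply: schreyer_gt.
Qed.

(** The common image of s and its partner t is divisible by the lead monomials of both generators,
    hence by their least common multiple; cancelling LM(f_i), where i is the index of s, gives the
    divisor of s. *)
Lemma syz_pair_lead v s :
  Syz G v -> LM sgt v = Some s ->
  exists p t, pair_lead p t /\ mdivides (Some t) (Some s).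
Proof.
move=> Sv vs; have [t ts st] := Syz_LM_partner Sv vs.
have [tE1 tE2] : (t.1 + (lm t.2).1 = s.1 + (lm s.2).1)%MM /\ (lm t.2).2 = (lm s.2).2.
  by split; [exact: (congr1 fst ts)|exact: (congr1 snd ts)].
exists (s.2, t.2), ((pair_lcm s.2 t.2 - (lm s.2).1)%MM, s.2).
split; first by apply: mji_monomial.
rewrite (surjective_pairing s) /mdivides eqxx; apply/mnm_lepP => q; rewrite mnmBE mnmE leq_subLR geq_max addnC.
by rewrite -[X in (_ <= X)%N]mnmDE leq_addl andbT -tE1 mnmDE leq_addl.
Qed.

(** * The set maintained by LeadSyz *)

Definition scanned s (S : seq (vmon n r)) : seq (vmon n r) :=
  let: (o, S') := scan s S in if o is Some s' then s' :: S' else S'.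

(** Only membership agrees: the scan puts s in front of the retained elements, the recursion behind
    s1. *)
Lemma scanned_cons s s1 S :
  scanned s (s1 :: S) =i
  if mdivides (Some s1) (Some s) then s1 :: S else
  if mdivides (Some s) (Some s1) then scanned s S else s1 :: scanned s S.
Proof.
rewrite /scanned /= => x; case: ifP => // _; case: (scan s S) => -[s'|] S';
  case: ifP => // _; by rewrite !inE orbCA.
Qed.

Lemma mdivides_refl s : mdivides (Some s) (Some s).
Proof. by apply/mdividesP; exists 0%MM; case: s => a i; rewrite /mshift add0m. Qed.

Lemma mdivides_trans (s1 s2 s3 : vmon n r) :
  mdivides (Some s1) (Some s2) -> mdivides (Some s2) (Some s3) ->
  mdivides (Some s1) (Some s3).
Proof.
move=> /mdividesP[a ->] /mdividesP[b ->]; apply/mdividesP.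
by exists (b + a)%MM; rewrite mshiftD.
Qed.

Lemma scanned_sub s S : {subset scanned s S <= s :: S}.
Proof.
elim: S => [|s1 S IH] x; first by [].
rewrite scanned_cons; case: ifP => _; first by move=> xS; rewrite inE xS orbT.
have sub : x \in scanned s S -> x \in s :: s1 :: S.
  by move/IH; rewrite !inE => /orP[]->; rewrite ?orbT.
case: ifP => _ // ; rewrite inE => /predU1P[->|/sub//].
by rewrite !inE eqxx orbT.
Qed.

(** The delicate case is an element removed because s divides it while s is discarded later: the
    element that divides s remains and, by transitivity, covers the removed one. *)
Lemma scanned_cover s S x :
  x \in s :: S -> exists2 y, y \in scanned s S & mdivides (Some y) (Some x).
Proof.
elim: S x => [|s1 S IH] x.
  by rewrite mem_seq1 => /eqP->; exists s; rewrite ?mem_head ?mdivides_refl.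
have [s1s|s1s] := boolP (mdivides (Some s1) (Some s)).
  have inE' y : (y \in scanned s (s1 :: S)) = (y \in s1 :: S).
    by rewrite scanned_cons s1s.
  rewrite inE => /predU1P[->|xS].
    by exists s1; rewrite ?inE' ?mem_head.
  by exists x; rewrite ?inE' ?mdivides_refl.
have sub y : y \in scanned s S -> y \in scanned s (s1 :: S).
  by rewrite scanned_cons (negPf s1s); case: ifP => // _; rewrite inE => ->; rewrite orbT.
have IH' y : y \in s :: S ->
    exists2 z, z \in scanned s (s1 :: S) & mdivides (Some z) (Some y).
  by case/IH=> z /sub; exists z.
rewrite inE => /predU1P[->|]; first exact/IH'/mem_head.
rewrite inE => /predU1P[->|xS]; last by apply: IH'; rewrite inE xS orbT.
have [ss1|ss1] := boolP (mdivides (Some s) (Some s1)).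
  have [y yS ys] := IH' s (mem_head _ _).
  by exists y => //; apply: mdivides_trans ys ss1.
exists s1; last exact: mdivides_refl.
by rewrite scanned_cons (negPf s1s) (negPf ss1) mem_head.
Qed.

(** Both invariants speak of membership alone, so the permutations between the scans do no harm:
    nothing foreign enters, and whatever was once inserted or tested stays covered. *)
Lemma leadsyz_runP ps S S' :
  leadsyz_run gt G ps S S' ->
  {subset ps <= lead_pairs gt G} ->
  (forall s, s \in S' -> s \in S \/ exists p, pair_lead p s) /\
  (forall s, (s \in S \/ exists2 p, p \in ps & pair_lead p s) ->
     exists2 t, t \in S' & mdivides (Some t) (Some s)).
Proof.
elim=> {ps S S'} [S|p ps S S0 S' S0S _ IH] psl.
  split=> [s|s [sS|[]//]]; first by left.
  by exists s; rewrite ?mdivides_refl.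
have [|IH1 IH2] := IH; first by move=> q qps; apply: psl; rewrite inE qps orbT.
have pl : p \in lead_pairs gt G by apply/psl/mem_head.
(* A listed pair has nonzero m_ji, so the [None] branch of [process_pair] is excluded. *)
have [s0 s0E] : exists s0, LM sgt (mji gt G p.2 p.1 *: basis_vec n K p.1) = Some s0.
  have [ij ji] := lead_pairsP pl; have [_] := mji_monomial ij ji.
  by exists ((pair_lcm p.1 p.2 - (lm p.1).1)%MM, p.1).
have procE : process_pair gt G p S0 = scanned s0 S0 by rewrite /process_pair s0E.
rewrite procE in IH1 IH2.
split=> [s /IH1[/scanned_sub|]|s].
- rewrite inE (perm_mem S0S) => /predU1P[->|]; [by right; exists p|by left].
- by right.
have cover x : x \in s0 :: S0 -> exists2 t, t \in S' & mdivides (Some t) (Some x).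
  case/scanned_cover=> y yS yx; have [|t tS' ty] := IH2 y; first by left.
  by exists t => //; apply: mdivides_trans ty yx.
case=> [sS|[q]]; first by apply: cover; rewrite inE (perm_mem S0S) sS orbT.
rewrite inE => /predU1P[->|qps ql]; last by apply: IH2; right; exists q.
by case=> _; rewrite s0E => -[<-]; apply: cover; apply: mem_head.
Qed.

Lemma LeadSyz_exists : exists S, LeadSyz gt G S.
Proof.
suff run ps S : exists S', leadsyz_run gt G ps S S'.
  have [S SP] := run (lead_pairs gt G) [::].
  by exists S, (lead_pairs gt G).
elim: ps S => [|p ps IH] S; first by exists S; apply: leadsyz_nil.
have [S' S'P] := IH (process_pair gt G p S).
by exists S'; apply: (leadsyz_cons (perm_refl S)).
Qed.

Lemma LeadSyz_syz S s :
  LeadSyz gt G S -> s \in S -> exists2 v, Syz G v & LM sgt v = Some s.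
Proof.
move=> [ps [psl /leadsyz_runP spec]] sS.
have [|run _] := spec; first by move=> p; rewrite (perm_mem psl).
by have [//|[p]] := run s sS; apply: pair_lead_syz.
Qed.

Lemma LeadSyz_cover S v s :
  LeadSyz gt G S -> Syz G v -> LM sgt v = Some s ->
  exists2 t, t \in S & mdivides (Some t) (Some s).
Proof.
move=> [ps [psl /leadsyz_runP spec]] Sv vs.
have [|_ run] := spec; first by move=> p; rewrite (perm_mem psl).
have [p [t [pt ts]]] := syz_pair_lead Sv vs.
have [|t' t'S t't] := run t; first by right; exists p; rewrite // (perm_mem psl) //; case: pt.
by exists t' => //; apply: mdivides_trans t't ts.
Qed.

(** * Executions of LiftSyz *)

Lemma LiftSyz_terminatesP : LiftSyz_terminates gt G.
Proof.
split=> [|S s SL sS]; first exact: LeadSyz_exists.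
have [v Sv vs] := LeadSyz_syz SL sS.
split; first exact: (lead_module_LM swo Sv vs).
exact: (LiftTree_terminates_vterm Sv vs (oner_neq0 K)).
Qed.

Lemma LiftSyz_exists : exists Sbar, LiftSyz gt G Sbar.
Proof.
have [S SL] := LeadSyz_exists.
have [s sS|lift liftP] := @seq_choice _ _
    (fun s sbar => LiftTree gt G (vterm 1 s) sbar) S 0.
  by have [v Sv vs] := LeadSyz_syz SL sS; apply: (LiftTree_exists Sv vs (oner_neq0 K)).
by exists [seq lift s | s <- S], S, lift.
Qed.

(** The lifts have exactly the elements of S as lead monomials, and these divide the lead monomial
    of every nonzero syzygy, so the divisibility criterion applies. *)
Lemma LiftSyz_grobner Sbar : LiftSyz gt G Sbar -> grobner_basis sgt (Syz G) Sbar.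
Proof.
move=> [S [lift [SL liftP ->]]].
have liftE s : s \in S -> Syz G (lift s) /\ LM sgt (lift s) = Some s.
  move=> sS; have [v Sv vs] := LeadSyz_syz SL sS.
  have [Sl ltE] := LiftTree_lift Sv vs (oner_neq0 K) (liftP s sS); split=> //.
  move: ltE; rewrite /LT; case: (LM sgt (lift s)) => [t|] E.
    by have [|_ ->//] := vterm_inj _ (esym E); rewrite oner_neq0.
  (* Without a lead monomial [LT] takes its default value 0, which is not the term s. *)
  have := LM0 K swo; rewrite [X in LM _ X = _]E LM_vterm ?oner_neq0 //.
apply: (grobner_basis_of_LM swo ssc Syz_submodule) => [g /mapP[s sS ->]|v s Sv vs].
  by case: (liftE s sS).
have [t tS /mdividesP[a sE]] := LeadSyz_cover SL Sv vs.
by exists (lift t), t, a; split=> //; [apply: map_f|case: (liftE t tS)].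
Qed.

End Schreyer.

Lemma module_monomial_ordering_shift n (K : fieldType) k (gt : rel (vmon n k)) :
  module_monomial_ordering K gt -> well_order gt /\ shift_compatible gt.
Proof.
move=> [wo [_ [_ [add _]]]]; split=> // a [b i] [c j] /(add _ _ a).
by rewrite /mshift /= ![(a + _)%MM]addmC.
Qed.

Theorem proposition4p2 (K : closedFieldType) (n m r : nat)
    (M : 'rV[skewpoly n K]_m -> Prop) (gt : rel (vmon n m))
    (G : r.-tuple 'rV[skewpoly n K]_m)
    (hM : submodule M) (hMfg : finitely_generated M)
    (hgt : module_monomial_ordering K gt)
    (hG : grobner_basis gt M G)
    (hG0 : forall i : 'I_r, tnth G i != 0) :
  (forall s : 'rV[skewpoly n K]_r,
     is_vterm s -> lead_module (schreyer gt G) (Syz G) s ->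
     [/\ LiftTree_terminates gt G s,
         (exists sbar, LiftTree gt G s sbar)
       & forall sbar, LiftTree gt G s sbar -> is_lift gt G s sbar]) /\
  (forall s : 'rV[skewpoly n K]_r,
     is_vterm s ->
     [/\ LiftSubtree_terminates gt G s,
         (exists sbar, LiftSubtree gt G s sbar)
       & forall sbar, LiftSubtree gt G s sbar -> is_subtree_lifting gt G s sbar]) /\
  [/\ LiftSyz_terminates gt G,
      (exists Sbar, LiftSyz gt G Sbar)
    & forall Sbar, LiftSyz gt G Sbar ->
        grobner_basis (schreyer gt G) (Syz G) Sbar].
Proof.
have [wo sc] := module_monomial_ordering_shift hgt.
have [lm lmE] := fin_all_exists (fun i => LM_exists wo (hG0 i)).
have swo := schreyer_well_order wo sc lmE.
have ssc := schreyer_shift wo sc lmE.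
split; [|split].
- move=> _ [c [s [c0 ->]]] sL.
  (* Membership in the lead module is traded for an actual syzygy v with the same lead monomial as
     s; its cancellation under phi provides the admissible choices. *)
  have [v Sv vs] := lead_module_vterm swo ssc (Syz_submodule G) c0 sL.
  split.
  + exact: (LiftTree_terminates_vterm wo sc lmE Sv vs).
  + exact: (LiftTree_exists wo sc lmE Sv vs).
  + by move=> sbar; apply: (LiftTree_lift wo sc lmE hG Sv vs).
- move=> _ [c [s [c0 ->]]]; split.
  + exact: (LiftSubtree_terminates_vterm wo sc lmE).
  + exact: (LiftSubtree_exists wo sc lmE).
  + by move=> sbar; apply: (LiftSubtree_lifting wo sc lmE).
split.
- exact: (LiftSyz_terminatesP wo sc lmE hG).
- exact: (LiftSyz_exists wo sc lmE hG).
- by move=> Sbar; apply: (LiftSyz_grobner wo sc lmE hG).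
Qed.
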